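(* For every $k\ge1$ and every partition $\lambda$, the eigenvalue of $A^{(k)}$ on $P_\lambda(X;q,t)$ is $$a_k(\lambda)=t^{-\binom k2}\,P_{(1^k)}^*\left(q^{-\lambda};q^{-1},t^{-1}\right).$$ Consequently, for every $n\ge k$, $$\frac{\mathcal F_k^{[n]}}{n!}=t^{-\binom k2}\sum_{\lambda\vdash n}\frac{P_{(1^k)}^*(q^{-\lambda};q^{-1},t^{-1})}{c'_\lambda(q,t)}P_\lambda(X;q,t).$$
   Context: $\mathrm{Sym}$ is the ring of symmetric functions over $\mathbb Q(q,t)$ in an alphabet $X$; completed series are formal infinite sums of homogeneous components. Macdonald functions. $\langle\cdot,\cdot\rangle_{q,t}$ is the Macdonald scalar product $\langle p_\lambda,p_\mu\rangle_{q,t}=\delta_{\lambda\mu}z_\lambda\prod_i\frac{1-q^{\lambda_i}}{1-t^{\lambda_i}}$. $P_\lambda(X;q,t)$ are the monic Macdonald functions and $J_\lambda=c_\lambda P_\lambda(X;q,t)$ the integral forms, where $c_\lambda(q,t)=\prod_{s\in\lambda}(1-q^{a(s)}t^{l(s)+1})$ and $c'_\lambda(q,t)=\prod_{s\in\lambda}(1-q^{a(s)+1}t^{l(s)})$, with $a(s),l(s)$ the arm and leg lengths. One has $\langle J_\lambda,J_\lambda\rangle_{q,t}=j_\lambda=c_\lambda c'_\lambda$. Product. In homogeneous degree $n$, let $\times_{q,t}$ be the product dual, for $\langle\cdot,\cdot\rangle_{q,t}$, to the coproduct $J_\lambda\mapsto\frac1{n!}J_\lambda\otimes J_\lambda$ ($\lambda\vdash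 n$). Equivalently $J_\lambda\times_{q,t}J_\mu=\delta_{\lambda\mu}\frac{j_\lambda}{n!}J_\lambda$ for $\lambda,\mu\vdash n$. Nazarov--Sklyanin operators at infinity. With $(u;t^{-1})_k=\prod_{r=0}^{k-1}(1-ut^{-r})$, let $a_k(\lambda)$ be defined by $$\prod_{i\ge1}\frac{q^{-\lambda_i}-ut^{1-i}}{1-ut^{1-i}}=1+\sum_{k\ge1}\frac{a_k(\lambda)}{(u;t^{-1})_k},$$ and let $A^{(k)}P_\lambda(X;q,t)=a_k(\lambda)P_\lambda(X;q,t)$. $\mathcal F_k=\sum_{n\ge k}\mathcal F_k^{[n]}$ is the unique completed series such that multiplication by $\mathcal F_k^{[n]}$ for $\times_{q,t}$ coincides with $A^{(k)}$ in degree $n$. Shifted Macdonald polynomials (Okounkov's normalization), with parameters $(Q,T)$. Put $n(\lambda)=\sum_i(i-1)\lambda_i$ and let $\lambda'$ be the conjugate of $\lambda$. $P_\mu^*(x;Q,T)$ is the interpolation polynomial characterized as follows: for every $N\ge\ell(\mu)$ it is a polynomial in $x_1,\dots,x_N$ of degree at most $|\mu|$, symmetric in the variables $x_iT^{1-i}$, compatible with setting the last variable equal to $1$, with $P_\mu^*(Q^\lambda;Q,T)=0$ for all $\lambda\ne\mu$ with $|\lambda|\le|\mu|$, $\ell(\lambda)\le N$, and $P_\mu^*(Q^\mu;Q,T)=(-1)^{|\mu|}Q^{n(\mu')}T^{-2n(\mu)}c'_\mu(Q,T)$; here $Q^\lambda=(Q^{\lambda_1},Q^{\lambda_2},\dots)$.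 In the claim it is taken at $Q=q^{-1}$, $T=t^{-1}$, $x=q^{-\lambda}=(q^{-\lambda_1},q^{-\lambda_2},\dots)$, and $\mu=(1^k)$ is the column partition. *)

(* Defs.v *)
From HB Require Import structures.
From mathcomp Require Import all_boot all_order all_algebra.
From mathcomp Require Import perm finmap.
From mathcomp Require Import boolp classical_sets.
From mathcomp Require Import mpoly.

Set Implicit Arguments.
Unset Strict Implicit.
Unset Printing Implicit Defensive.

Import GRing.Theory.

Local Open Scope ring_scope.


Definition is_part (s : seq nat) : bool := sorted geq s && (0%N \notin s).

Record intpart := IntPart { part :> seq nat; partP : is_part part }.

HB.instance Definition _ := [isSub for part].
HB.instance Definition _ := [Countable of intpart by <:].

Definition partitions (n : nat) : seq intpart :=
  pmap insub [seq s <- [seq map val (bseqval s) | s <- enum {: n.-bseq 'I_n.+1}]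
             | sumn s == n].

Lemma partitions_uniq n : uniq (partitions n).
Proof.
apply/pmap_sub_uniq/filter_uniq; rewrite map_inj_uniq ?enum_uniq //.
by move=> s1 s2 /(inj_map val_inj)/val_inj.
Qed.

Lemma mem_partitions n (lam : intpart) :
  (lam \in partitions n) = (sumn lam == n).
Proof.
rewrite mem_pmap_sub mem_filter andb_idr // => /eqP; rewrite -[val lam]/(part lam) => sum_lam.
have /andP[_ lam_gt0] := partP lam.
have le_sum r : r \in part lam -> (r < n.+1)%N.
  by move=> r_lam; rewrite ltnS -sum_lam sumnE (big_rem r) //= leq_addr.
have size_lam : (size [seq inord r : 'I_n.+1 | r <- part lam] <= n)%N.
  rewrite size_map -sum_lam; move: lam_gt0; elim: (part lam) => //= r s IHs.
  rewrite inE negb_or => /andP[r_neq0 /IHs le_s]; rewrite -add1n leq_add //.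
  by case: r r_neq0.
apply/mapP; exists (Bseq size_lam); first by rewrite mem_enum.
rewrite /= -map_comp -[LHS]map_id; apply/eq_in_map => r /le_sum r_le /=.
by rewrite inordK.
Qed.

Lemma is_part_col k : is_part (nseq k 1%N).
Proof.
rewrite /is_part; apply/andP; split; last by elim: k.
by case: k => // k; elim: k => //= k ->.
Qed.

Definition colpart k : intpart := IntPart (is_part_col k).

(* parts, rows and columns are numbered from 0, hence the shifts in arm, leg
   and nstat *)
Definition conj_part (lam : seq nat) : seq nat :=
  mkseq (fun j => count (fun r => j < r)%N lam) (head 0%N lam).

Definition arm (lam : seq nat) (i j : nat) : nat := (nth 0 lam i - j.+1)%N.
Definition leg (lam : seq nat) (i j : nat) : nat :=
  (nth 0 (conj_part lam) j - i.+1)%N.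

Definition nstat (lam : seq nat) : nat :=
  (\sum_(i < size lam) i * nth 0 lam i)%N.

Definition zpart (lam : seq nat) : nat :=
  (\prod_(r <- undup lam) (r ^ count_mem r lam * (count_mem r lam)`!))%N.

Definition dominated (mu lam : seq nat) : bool :=
  (sumn mu == sumn lam) &&
  [forall i : 'I_(size mu).+1, sumn (take i mu) <= sumn (take i lam)]%N.


(* Sym is the graded inverse limit of the rings of symmetric polynomials: an
   element is a family of symmetric polynomials, one for each number N of
   variables, of bounded degree and compatible with x_N = 0. *)
Section SymmetricFunctions.
Variable K : fieldType.

Definition mpfam := forall N : nat, {mpoly K[N]}.

HB.instance Definition _ := Choice.on mpfam.

Implicit Types f g h : mpfam.

Let addf f g : mpfam := fun N => f N + g N.
Let oppf f : mpfam := fun N => - f N.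
Let mulf f g : mpfam := fun N => f N * g N.
Let scalef (a : K) f : mpfam := fun N => a *: f N.

Fact mpfam_addA : associative addf.
Proof. by move=> f g h; apply: functional_extensionality_dep => N; exact: addrA. Qed.
Fact mpfam_addC : commutative addf.
Proof. by move=> f g; apply: functional_extensionality_dep => N; exact: addrC. Qed.
Fact mpfam_add0 : left_id ((fun N => 0) : mpfam) addf.
Proof. by move=> f; apply: functional_extensionality_dep => N; exact: add0r. Qed.
Fact mpfam_addN : left_inverse ((fun N => 0) : mpfam) oppf addf.
Proof. by move=> f; apply: functional_extensionality_dep => N; exact: addNr. Qed.

HB.instance Definition _ :=
  GRing.isZmodule.Build mpfam mpfam_addA mpfam_addC mpfam_add0 mpfam_addN.

Fact mpfam_mulA : associative mulf.
Proof. by move=> f g h; apply: functional_extensionality_dep => N; exact: mulrA. Qed.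
Fact mpfam_mulC : commutative mulf.
Proof. by move=> f g; apply: functional_extensionality_dep => N; exact: mulrC. Qed.
Fact mpfam_mul1 : left_id ((fun N => 1) : mpfam) mulf.
Proof. by move=> f; apply: functional_extensionality_dep => N; exact: mul1r. Qed.
Fact mpfam_mulDl : left_distributive mulf +%R.
Proof. by move=> f g h; apply: functional_extensionality_dep => N; exact: mulrDl. Qed.
Fact mpfam_1neq0 : ((fun N => 1) : mpfam) != 0.
Proof. by apply/eqP => /(congr1 (fun f : mpfam => f 0%N))/eqP; rewrite oner_eq0. Qed.

HB.instance Definition _ := GRing.Zmodule_isComNzRing.Build mpfam
  mpfam_mulA mpfam_mulC mpfam_mul1 mpfam_mulDl mpfam_1neq0.

Fact mpfam_scaleA a b f : scalef a (scalef b f) = scalef (a * b) f.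
Proof. by apply: functional_extensionality_dep => N; exact: scalerA. Qed.
Fact mpfam_scale1 : left_id 1 scalef.
Proof. by move=> f; apply: functional_extensionality_dep => N; exact: scale1r. Qed.
Fact mpfam_scaleDr : right_distributive scalef +%R.
Proof. by move=> a f g; apply: functional_extensionality_dep => N; exact: scalerDr. Qed.
Fact mpfam_scaleDl f : {morph scalef^~ f : a b / a + b}.
Proof. by move=> a b; apply: functional_extensionality_dep => N; exact: scalerDl. Qed.

HB.instance Definition _ := GRing.Zmodule_isLmodule.Build K mpfam
  mpfam_scaleA mpfam_scale1 mpfam_scaleDr mpfam_scaleDl.

Fact mpfam_scaleAl (a : K) (f g : mpfam) : a *: (f * g) = (a *: f) * g.
Proof. by apply: functional_extensionality_dep => N; exact: scalerAl. Qed.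

HB.instance Definition _ :=
  GRing.Lmodule_isLalgebra.Build K mpfam mpfam_scaleAl.
HB.instance Definition _ := GRing.Lalgebra_isComAlgebra.Build K mpfam.

Definition set_last (c : K) N (p : {mpoly K[N.+1]}) : {mpoly K[N]} :=
  p \mPo [tuple if unlift ord_max i is Some j then 'X_j else c%:MP
         | i < N.+1].

Definition symmetric_function (f : mpfam) : Prop :=
  [/\ forall N, f N \is symmetric,
      forall N, set_last 0 (f N.+1) = f N
    & exists d, forall N, (msize (f N) <= d)%N].

Definition symfun_pred : {pred mpfam} := fun f => `[< symmetric_function f >].

Fact symfun_subalg_closed : subalg_closed symfun_pred.
Proof.
split=> [|a f g|f g]; first (apply/asboolP; split).
- by move=> N; exact: rpred1.
- by move=> N; rewrite /set_last rmorph1.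
- by exists 1%N => N; rewrite msize1.
- move=> /asboolP[f_sym f_st [d f_d]] /asboolP[g_sym g_st [e g_e]].
  apply/asboolP; split.
  + by move=> N; exact: (rpredD (rpredZ a (f_sym N)) (g_sym N)).
  + by move=> N; rewrite -[RHS]/(a *: f N + g N) -f_st -g_st; exact: linearP.
  + exists (maxn d e) => N; apply: leq_trans (msizeD_le (a *: f N) (g N)) _.
    by rewrite geq_max !leq_max (leq_trans (msizeZ_le _ _) (f_d N)) g_e orbT.
- move=> /asboolP[f_sym f_st [d f_d]] /asboolP[g_sym g_st [e g_e]].
  apply/asboolP; split.
  + by move=> N; exact: (rpredM (f_sym N) (g_sym N)).
  + by move=> N; rewrite -[RHS]/(f N * g N) -f_st -g_st; exact: rmorphM.
  + exists (d + e).+1 => N; apply: leq_trans (msizeM_le (f N) (g N)) _.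
    by rewrite ltnS leq_add.
Qed.

HB.instance Definition _ :=
  GRing.isSubalgClosed.Build K mpfam symfun_pred symfun_subalg_closed.

Record symfun :=
  SymFun { symfun_val : mpfam; symfunP : symfun_val \in symfun_pred }.

HB.instance Definition _ := [isSub for symfun_val].
HB.instance Definition _ := [Choice of symfun by <:].
HB.instance Definition _ := [SubChoice_isSubComNzRing of symfun by <:].
HB.instance Definition _ := [SubZmodule_isSubLmodule of symfun by <:].
HB.instance Definition _ := [SubNzRing_SubLmodule_isSubLalgebra of symfun by <:].
HB.instance Definition _ := [SubLalgebra_isSubAlgebra of symfun by <:].

Definition homogeneous (n : nat) (f : symfun) : Prop :=
  forall N, val f N \is n.-homog.

Definition powersum (r : nat) : mpfam := fun N => \sum_(i < N) 'X_i ^+ r.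

(* m_lam, the sum of all distinct monomials whose nonzero exponents are the
   parts of lam *)
Definition monosym (lam : intpart) : mpfam := fun N =>
  \sum_(m : 'X_{1..N < (sumn lam).+1}
        | perm_eq [seq e <- bmnm m | e != 0%N] lam) 'X_[m].

Lemma unlift_widen n (i : 'I_n) :
  unlift ord_max (widen_ord (leqnSn n) i) = Some i.
Proof.
have -> : widen_ord (leqnSn n) i = lift ord_max i.
  by apply: ord_inj; rewrite lift_max.
exact: liftK.
Qed.

Lemma set_last0_coef N (p : {mpoly K[N.+1]}) (m : 'X_{1..N}) :
  (set_last 0 p)@_m = p@_(mnmwiden m).
Proof.
rewrite /set_last comp_mpolyEX [X in _ = X@__]mpolyE !raddf_sum /=.
apply: eq_bigr => e _; rewrite !mcoeffZ; congr (_ * _).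
rewrite comp_mpolyX big_ord_recr /= tnth_mktuple unlift_none.
under eq_bigr => i _ do rewrite tnth_mktuple unlift_widen.
rewrite mcoeffX; case: eqP => [->|e_m].
  rewrite mnmwiden_ordmax expr0 mulr1.
  under eq_bigr => i _ do rewrite mnmwiden_widen.
  by rewrite -mpolyXE_id mcoeffX eqxx.
case: (posnP (e ord_max)) => [e0|e_gt0]; last first.
  by rewrite mpolyC0 expr0n gtn_eqF // mulr0 mcoeff0.
rewrite e0 expr0 mulr1.
pose e' : 'X_{1..N} := [multinom e (widen_ord (leqnSn N) i) | i < N].
have -> : \prod_(i < N) 'X_i ^+ e (widen_ord (leqnSn N) i)
          = 'X_[e'] :> {mpoly K[N]}.
  by rewrite [RHS]mpolyXE_id; apply: eq_bigr => i _; rewrite mnmE.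
rewrite mcoeffX; case: eqP => // m_e; case: e_m.
apply/mnmP => i; case: (unliftP ord_max i) => [j|] ->.
  have -> : lift ord_max j = widen_ord (leqnSn N) j.
    by apply: ord_inj; rewrite lift_max.
  by rewrite mnmwiden_widen -m_e mnmE.
by rewrite mnmwiden_ordmax e0.
Qed.

Lemma powersum_symfun r : (0 < r)%N -> powersum r \in symfun_pred.
Proof.
move=> r_gt0; apply/asboolP; split.
- move=> N; apply/issymP => s; rewrite raddf_sum [RHS](reindex_inj (@perm_inj _ s)) /=.
  by apply: eq_bigr => i _; rewrite rmorphXn /= /msym mmapX mmap1U.
- move=> N; rewrite /powersum /set_last raddf_sum big_ord_recr /=.
  rewrite rmorphXn /= comp_mpolyXU -tnth_nth tnth_mktuple unlift_none.
  rewrite mpolyC0 expr0n gtn_eqF // addr0; apply: eq_bigr => i _.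
  by rewrite rmorphXn /= comp_mpolyXU -tnth_nth tnth_mktuple unlift_widen.
- exists r.+1 => N; apply: leq_trans (msize_sum _ _ _) _.
  apply/bigmax_leqP => i _; rewrite mpolyXn msizeX.
  by rewrite mdegMn mdeg1 mul1n.
Qed.

Lemma monosym_coef (lam : intpart) N (m : 'X_{1..N}) :
  (monosym lam N)@_m = (perm_eq [seq e <- m | e != 0%N] lam)%:R.
Proof.
rewrite /monosym raddf_sum /=.
case: (boolP (perm_eq _ _)) => [m_lam|m_lam] /=.
  have deg_m : (mdeg m < (sumn lam).+1)%N.
    rewrite ltnS -(perm_sumn m_lam) sumnE big_filter big_mkcond /mdeg.
    by apply: leq_sum => e _; case: eqP => // ->.
  rewrite (bigD1 (BMultinom deg_m)) //= mcoeffX eqxx big1 ?addr0 // => e.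
  case/andP=> _ e_m; rewrite mcoeffX; case: eqP => // em.
  by case/eqP: e_m; apply: val_inj.
rewrite big1 // => e e_lam; rewrite mcoeffX; case: eqP => // e_m.
by rewrite -e_m e_lam in m_lam.
Qed.

Lemma monosym_symfun lam : monosym lam \in symfun_pred.
Proof.
apply/asboolP; split.
- move=> N; apply/issymP => s; apply/mpolyP => m.
  rewrite mcoeff_sym !monosym_coef; congr (_%:R).
  congr (nat_of_bool _); set m' := multinom_val _.
  have /permPl-> // : perm_eq [seq e <- m' | e != 0%N] [seq e <- m | e != 0%N].
  apply/perm_filter/tuple_permP; exists s.
  by congr val; apply: eq_from_tnth => i; rewrite tnth_mktuple.
- move=> N; apply/mpolyP => m; rewrite set_last0_coef !monosym_coef.
  by rewrite /= filter_rcons.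
- exists (sumn lam).+1 => N; apply: leq_trans (msize_sum _ _ _) _.
  by apply/bigmax_leqP => e _; rewrite msizeX (valP e).
Qed.

Definition msymf (lam : intpart) : symfun := SymFun (monosym_symfun lam).

(* junk value 0 for r = 0, where powersum 0 is not a compatible family *)
Definition psymf1 (r : nat) : symfun := insubd 0 (powersum r).

Lemma psymf1E r : (0 < r)%N -> val (psymf1 r) = powersum r.
Proof. by move=> r_gt0; rewrite insubdK // powersum_symfun. Qed.

Definition psymf (lam : intpart) : symfun := \prod_(r <- part lam) psymf1 r.

(* for a basis b of Sym, the unique c; unspecified otherwise *)
Definition coord (b : intpart -> symfun) (f : symfun) :
    {fsfun intpart -> K with 0} :=
  xget [fsfun] [set c : {fsfun intpart -> K with 0} |
                f = \sum_(lam <- finsupp c) c lam *: b lam].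

End SymmetricFunctions.

Arguments psymf {K} lam.
Arguments msymf {K} lam.


Section Macdonald.
Variables (K : fieldType) (q t : K).

Definition clow (lam : seq nat) : K :=
  \prod_(i < size lam) \prod_(j < nth 0%N lam i)
    (1 - q ^+ arm lam i j * t ^+ (leg lam i j).+1).

Definition cup (lam : seq nat) : K :=
  \prod_(i < size lam) \prod_(j < nth 0%N lam i)
    (1 - q ^+ (arm lam i j).+1 * t ^+ leg lam i j).

Definition jnorm (lam : seq nat) : K := clow lam * cup lam.

(* the bilinear form for which the power sums p_lam are orthogonal with
   <p_lam, p_lam> = z_lam \prod_i (1 - q^(lam_i)) / (1 - t^(lam_i)) *)
Definition scalar_qt (f g : symfun K) : K :=
  \sum_(lam <- finsupp (coord psymf f))
    coord psymf f lam * coord psymf g lam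
    * ((zpart lam)%:R * \prod_(r <- part lam) ((1 - q ^+ r) / (1 - t ^+ r))).

Definition macdonald_functions (P : intpart -> symfun K) : Prop :=
  (forall lam, exists u : intpart -> K,
     P lam = msymf lam
             + \sum_(mu <- partitions (sumn lam)
                    | (mu != lam) && dominated mu lam) u mu *: msymf mu)
  /\ (forall lam mu, lam != mu -> scalar_qt (P lam) (P mu) = 0).

Variable P : intpart -> symfun K.

Definition Jint (lam : intpart) : symfun K := clow lam *: P lam.

(* on degree n, extended bilinearly from
   J_lam x J_mu = \delta_(lam, mu) (j_lam / n!) J_lam *)
Definition times_qt (n : nat) (f g : symfun K) : symfun K :=
  \sum_(lam <- partitions n)
    (coord Jint f lam * coord Jint g lam * (jnorm lam / n`!%:R)) *: Jint lam.

(* (u; x)_k as a polynomial in u *)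
Definition qpochhammer (x : K) (k : nat) : {poly K} :=
  \prod_(r < k) (1 - x ^+ r *: 'X).

(* a k stands for a_k(lam). This is an identity in the field K(u) of rational functions.
   The factors with i > l(lam) of the product over i are 1, and the sum over k
   is finite. *)
Definition ns_expansion (lam : intpart) (a : nat -> K) : Prop :=
  exists2 M : nat, (forall k, (M < k)%N -> a k = 0) &
    \prod_(i < size lam)
       (tofrac ((q ^- nth 0%N lam i)%:P - t ^- i *: 'X)
        / tofrac (1 - t ^- i *: 'X))
    = 1 + \sum_(1 <= k < M.+1)
            tofrac (a k)%:P / tofrac (qpochhammer t^-1 k)
    :> {fraction {poly K}}.

(* A^(k), extended linearly from A^(k) P_lam = a_k(lam) P_lam *)
Definition ns_operator (a : nat -> intpart -> K) (k : nat) (f : symfun K) :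
    symfun K :=
  \sum_(lam <- finsupp (coord P f)) (coord P f lam * a k lam) *: P lam.

(* F is the sequence of the homogeneous components F_k^[n] of the completed
   series F_k *)
Definition ns_series (a : nat -> intpart -> K) (k : nat)
    (F : nat -> symfun K) : Prop :=
  [/\ forall n, homogeneous n (F n),
      forall n, (n < k)%N -> F n = 0
    & forall n, (k <= n)%N -> forall f, homogeneous n f ->
        times_qt n (F n) f = ns_operator a k f].

End Macdonald.


Section ShiftedMacdonald.
Variables (K : fieldType) (Q T : K).

Definition qpoint (lam : seq nat) (N : nat) : 'I_N -> K :=
  fun i => Q ^+ nth 0%N lam i.

Definition shifted_symmetric N (p : {mpoly K[N]}) : Prop :=
  exists2 g : {mpoly K[N]}, g \is symmetric
    & p = g \mPo [tuple T ^- i *: 'X_i | i < N].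

(* only the f N with N >= l(mu) are constrained *)
Definition shifted_macdonald (mu : intpart) (f : mpfam K) : Prop :=
  (forall N, (size mu <= N)%N -> set_last 1 (f N.+1) = f N) /\
  (forall N, (size mu <= N)%N ->
    [/\ (msize (f N) <= (sumn mu).+1)%N,
        shifted_symmetric (f N),
        forall lam : intpart, (size lam <= N)%N -> (sumn lam <= sumn mu)%N ->
          lam != mu -> (f N).@[qpoint lam (N := N)] = 0
      & (f N).@[qpoint mu (N := N)]
        = (-1) ^+ sumn mu * Q ^+ nstat (conj_part mu) * T ^- (2 * nstat mu)
          * cup Q T mu]).

(* f(Q^lam), in a number of variables that is large enough for both mu and
   lam; any larger number gives the same value *)
Definition shifted_eval (mu : intpart) (f : mpfam K) (lam : intpart) : K :=
  (f (maxn (size mu) (size lam))).@[qpoint lam (N := _)].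

End ShiftedMacdonald.

Notation Qqt := {fraction {mpoly rat[2]}}.
Definition q : Qqt := tofrac ('X_ord0 : {mpoly rat[2]}).
Definition t : Qqt := tofrac ('X_ord_max : {mpoly rat[2]}).

(* Main.v *)
Require Import Defs.
From mathcomp Require Import all_boot all_order all_algebra.
From mathcomp Require Import perm finmap boolp classical_sets.
From mathcomp Require Import mpoly.
From mathcomp Require Import ring.

(* With T = 1/t, Q = 1/q and N >= l(lambda) variables, clearing denominators in
   the expansion that defines a_k(lambda) gives
     \prod_(i < N) (Q^(lambda_i) - u T^i)
       = \sum_(k <= N) a_k(lambda) \prod_(k <= r < N) (1 - u T^r).
   The polynomials on the right form a basis graded by degree in u, and
   Q^(lambda_i) - u T^i = T^i (y_i - u) with y_i = T^(-i) Q^(lambda_i), so by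
   Viete a_k is a symmetric polynomial of degree at most k in the y_i.
   Evaluating at u = t^(k-1) shows that a_k vanishes on partitions with fewer
   than k rows and computes it on (1^k). These are the values that characterize
   t^(-binomial(k,2)) P*_(1^k), so the two agree as soon as a shifted symmetric
   polynomial of degree at most k that vanishes on all partitions of size at
   most k is zero. To prove this, set the last variable to the value of an empty
   row: by induction on N the result is zero, so by symmetry the polynomial is
   divisible by \prod_i (y_i - T^(1-N)), and the quotient vanishes at the
   partitions with one column removed.

   For the series, P is unitriangular over the monomial basis, hence a basis in
   each degree, and F_k^[n] is read off by multiplying it with each P_mu. *)

Set Implicit Arguments.
Unset Strict Implicit.
Unset Printing Implicit Defensive.

Import GRing.Theory.
Local Open Scope ring_scope.

(** * Interpolation by shifted symmetric polynomials *)

Section Specialization.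
Variables (K : fieldType) (n : nat).
Implicit Types (p r : {mpoly K[n]}) (i j : 'I_n) (c : K).

Lemma msizeXsubC i c : msize ('X_i - c%:MP : {mpoly K[n]}) = 2.
Proof.
apply/eqP; rewrite eqn_leq; apply/andP; split.
  apply: leq_trans (msizeD_le _ _) _; rewrite geq_max msizeX mdeg1 /=.
  by rewrite msizeN msizeC; case: (c != 0).
have := @msize_mdeg_lt n K ('X_i - c%:MP) U_(i)%MM; rewrite mdeg1; apply.
rewrite mcoeff_msupp mcoeffB mcoeffXU eqxx mcoeffC.
by rewrite -mdeg_eq0 mdeg1 mulr0 subr0 oner_eq0.
Qed.

Lemma mpolyXsubC_neq0 i c : 'X_i - c%:MP != 0 :> {mpoly K[n]}.
Proof. by rewrite -msize_poly_eq0 msizeXsubC. Qed.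

(** Constants and variables are congruent to their images under [phi] modulo ['X_i - c%:MP], and
    this congruence is compatible with sums and products. *)
Lemma specialization_dvd i c (phi : {rmorphism {mpoly K[n]} -> {mpoly K[n]}}) :
    (forall d, phi d%:MP = d%:MP) -> phi 'X_i = c%:MP ->
    (forall j, j != i -> phi 'X_j = 'X_j) ->
  forall p, exists r, p = phi p + ('X_i - c%:MP) * r.
Proof.
move=> phiC phiXi phiX.
pose C p := exists r, p = phi p + ('X_i - c%:MP) * r.
have CC d : C d%:MP by exists 0; rewrite phiC mulr0 addr0.
have CM p1 p2 : C p1 -> C p2 -> C (p1 * p2).
  (* The witness comes from [p1 * p2 - phi p1 * phi p2 = (p1 - phi p1) * p2 + phi p1 * (p2 - phi
     p2)]. *)
  move=> [r1 e1] [r2 e2]; exists (r1 * p2 + phi p1 * r2).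
  by rewrite rmorphM mulrDr mulrA mulrCA addrCA -mulrDr -e2 -mulrDl addrC -e1.
have CD p1 p2 : C p1 -> C p2 -> C (p1 + p2).
  move=> [r1 e1] [r2 e2]; exists (r1 + r2).
  by rewrite rmorphD mulrDr addrACA -e1 -e2.
have CX j : C 'X_j.
  have [->|ji] := eqVneq j i; first by exists 1; rewrite phiXi mulr1 addrC subrK.
  by exists 0; rewrite phiX // mulr0 addr0.
elim/mpolyind => [|d m p _ _ Cp]; first by rewrite -mpolyC0; exact: CC.
apply: (CD _ _ _ Cp); rewrite -mul_mpolyC; apply: (CM) => //; rewrite mpolyXE_id.
apply: (big_ind C); [exact: (CC 1) | exact: CM | move=> j _].
by elim: (m j) => [|e IHe]; rewrite ?exprS; [exact: (CC 1)|exact: CM].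
Qed.

Definition subst_var i c : n.-tuple {mpoly K[n]} :=
  [tuple if j == i then c%:MP else 'X_j | j < n].

Lemma comp_subst_var i c j :
  'X_j \mPo subst_var i c = if j == i then c%:MP else 'X_j.
Proof. by rewrite comp_mpolyXU -tnth_nth tnth_mktuple. Qed.

Lemma subst_var_dvd i c p : exists r, p = p \mPo subst_var i c + ('X_i - c%:MP) * r.
Proof.
apply: specialization_dvd => [d||j /negPf ji] /=.
- by rewrite comp_mpolyC.
- by rewrite comp_subst_var eqxx.
- by rewrite comp_subst_var ji.
Qed.

(** Setting ['X_i] to [c] annihilates [p] but no factor ['X_j - c%:MP] with [j != i], so it
    annihilates the cofactor, which is then divisible by ['X_i - c%:MP]. Over a field, each factor
    lowers the degree by exactly one. *)
Lemma dvd_prod_XsubC c (s : seq 'I_n) p : uniq s -> p != 0 ->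
    (forall i, i \in s -> exists r, p = ('X_i - c%:MP) * r) ->
  exists r, p = (\prod_(i <- s) ('X_i - c%:MP)) * r /\ (msize r + size s = msize p)%N.
Proof.
move=> + p_nz; elim: s => [|i s IHs] /=; first by exists p; rewrite big_nil mul1r addn0.
case/andP=> i_s s_uniq dvd_p.
have [j js|r [p_r sz_r]] := IHs s_uniq; first by apply: dvd_p; rewrite inE js orbT.
have [r' p_r'] := dvd_p i (mem_head _ _).
have r0 : r \mPo subst_var i c = 0.
  have := congr1 (comp_mpoly (subst_var i c)) p_r'.
  rewrite rmorphM rmorphB /= comp_subst_var eqxx comp_mpolyC subrr mul0r.
  rewrite p_r rmorphM => /eqP; rewrite mulf_eq0 => /orP[|/eqP //].
  rewrite rmorph_prod /= prodf_seq_eq0 => /hasP[j j_s].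
  rewrite /= rmorphB /= comp_subst_var comp_mpolyC.
  have -> : (j == i) = false by apply: contraNF i_s => /eqP <-.
  by rewrite (negPf (mpolyXsubC_neq0 _ _)).
have [r1] := subst_var_dvd i c r; rewrite r0 add0r => r_r1; exists r1.
split; first by rewrite big_cons p_r {1}r_r1 mulrCA mulrA.
have r_nz : r != 0 by apply: contraNneq p_nz; rewrite p_r => ->; rewrite mulr0.
rewrite -sz_r r_r1 msizeM ?msizeXsubC ?mpolyXsubC_neq0 ?addnS //.
by apply: contraNneq r_nz; rewrite r_r1 => ->; rewrite mulr0.
Qed.

Lemma mcoeff_scale_vars (c : 'I_n -> K) p m :
  (p \mPo [tuple c i *: 'X_i | i < n])@_m = (\prod_(i < n) c i ^+ m i) * p@_m.
Proof.
rewrite comp_mpolyEX [in RHS](mpolyE p) !raddf_sum /= mulr_sumr.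
apply: eq_bigr => e _; rewrite !mcoeffZ mulrCA; congr (_ * _).
rewrite comp_mpolyX.
rewrite (eq_bigr (fun i => (c i ^+ e i)%:MP * 'X_i ^+ e i)) => [|i _]; last first.
  by rewrite tnth_mktuple exprZn mul_mpolyC.
rewrite big_split /= -mpolyXE_id -rmorph_prod mul_mpolyC mcoeffZ mcoeffX.
by case: eqP => [->|]; rewrite ?mulr0.
Qed.

Lemma msize_scale_vars (c : 'I_n -> K) p : (forall i, c i != 0) ->
  msize (p \mPo [tuple c i *: 'X_i | i < n]) = msize p.
Proof.
move=> c_nz; rewrite !msizeE; apply/perm_big/uniq_perm; rewrite ?msupp_uniq //.
move=> m; rewrite !mcoeff_msupp mcoeff_scale_vars mulf_eq0 negb_or.
by rewrite prodf_seq_neq0 (@introT _ _ allP) // => i _; exact: expf_neq0.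
Qed.

End Specialization.

(** * Specializing the last variable *)

Section SetLast.
Variables (K : fieldType) (n : nat) (c : K).
Implicit Types (p : {mpoly K[n.+1]}).

Definition last_tuple : n.+1.-tuple {mpoly K[n]} :=
  [tuple if unlift ord_max i is Some j then 'X_j else c%:MP | i < n.+1].

(** Followed by [mwiden], [set_last c] is an endomorphism of the larger ring, to which
    [specialization_dvd] applies. *)
Lemma set_last_dvd p :
  exists r, p = mwiden (set_last c p) + ('X_ord_max - c%:MP) * r.
Proof.
apply: (specialization_dvd
  (phi := (@mwiden n K \o @comp_mpoly n.+1 K n last_tuple))) => [d||j] /=.
- by rewrite comp_mpolyC mwidenC.
- by rewrite comp_mpolyXU -tnth_nth tnth_mktuple unlift_none mwidenC.
- rewrite comp_mpolyXU -tnth_nth tnth_mktuple.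
  case: (unliftP ord_max j) => [i|] -> //; last by rewrite eqxx.
  move=> _; rewrite mwidenX mnmwiden1; congr 'X_[U_(_)].
  by apply: ord_inj; rewrite lift_max.
Qed.

Lemma set_last_sym p : p \is symmetric -> set_last c p \is symmetric.
Proof.
move=> p_sym; apply: (msym_comp_poly p_sym) => s.
(* A permutation of the first [n] variables extends to all of them by fixing the last. *)
apply/tuple_permP; exists (lift_perm ord_max ord_max s^-1)%g.
congr val; apply: eq_from_tnth => i; rewrite !tnth_mktuple -tnth_nth tnth_mktuple.
case: (unliftP ord_max i) => [j|] ->.
  rewrite lift_perm_lift !liftK msymX; congr 'X_[_]; apply/mnmP => l.
  by rewrite !mnmE -[l in RHS](permK s^-1)%g invgK (inj_eq perm_inj) ?permKV.
by rewrite lift_perm_id unlift_none /msym mmapC.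
Qed.

Lemma msize_set_last p : (msize (set_last c p) <= msize p)%N.
Proof.
rewrite /set_last comp_mpolyEX; apply: leq_trans (msize_sum _ _ _) _.
apply/bigmax_leqP_seq => m m_p _; apply: leq_trans (msizeZ_le _ _) _.
rewrite comp_mpolyX big_ord_recr /= tnth_mktuple unlift_none.
under eq_bigr => i _ do rewrite tnth_mktuple unlift_widen.
rewrite -rmorphXn mulrC mul_mpolyC; apply: leq_trans (msizeZ_le _ _) _.
pose e : 'X_{1..n} := [multinom m (widen_ord (leqnSn n) i) | i < n].
have -> : \prod_(i < n) 'X_i ^+ m (widen_ord (leqnSn n) i) = 'X_[e] :> {mpoly K[n]}.
  by rewrite [RHS]mpolyXE_id; apply: eq_bigr => i _; rewrite mnmE.
rewrite msizeX; apply: leq_ltn_trans (msize_mdeg_lt m_p).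
rewrite !mdegE big_ord_recr /=; apply: leq_trans (leq_addr _ _).
by rewrite leq_eqVlt; apply/orP; left; apply/eqP/eq_bigr => i _; rewrite mnmE.
Qed.

Lemma meval_set_last p (v : 'I_n -> K) :
  (set_last c p).@[v] = p.@[fun i => if unlift ord_max i is Some j then v j else c].
Proof.
rewrite /set_last comp_mpoly_meval; apply: meval_eq => i; rewrite tnth_mktuple.
by case: unlift => [j|]; rewrite ?mevalXU ?mevalC.
Qed.

End SetLast.

Section Interpolation.
Variables (K : fieldType) (Q T : K).
Hypotheses (T_neq0 : T != 0) (QT_generic : forall a b, Q ^+ a.+1 * T ^+ b != 1).


(* The induction needs the extra parameter z: removing the first column of the
   partitions replaces z by z * Q. *)
Lemma interpolation_unique N k (z : K) (g : {mpoly K[N]}) :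
    z != 0 -> Q != 0 -> g \is symmetric -> (msize g <= k.+1)%N ->
    (forall lam : 'I_N -> nat, {homo lam : i j / (i <= j)%N >-> (j <= i)%N} ->
       (\sum_i lam i <= k)%N -> g.@[fun i => z * T ^- i * Q ^+ lam i] = 0) ->
  g = 0.
Proof.
move=> + Q_nz; elim: N k z g => [|N IHN] k z g.
  move=> _ _ _ /(_ (fun=> 0%N)); rewrite big_ord0 => /(_ _ isT) g0.
  by move: g0; rewrite -(mpolyKC g) mevalC => ->.
elim/ltn_ind: k z g => k IHk z g z_nz g_sym g_k g_van; apply/eqP/negPn/negP => g_nz.
(* The value of the last variable at an empty last row. *)
pose c := z * T ^- N.
have h0 : set_last c g = 0.
  apply: (IHN k z) => //; first exact: set_last_sym.
    exact: leq_trans (msize_set_last _ _) g_k.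
  move=> lam lam_mono lam_k; rewrite meval_set_last.
  pose lam' i := if unlift ord_max i is Some j then lam j else 0%N.
  rewrite -[RHS](g_van lam'); first 1 last.
  - move=> i j; rewrite /lam'.
    case: (unliftP ord_max i) => [i'|] ->; case: (unliftP ord_max j) => [j'|] -> //.
      by rewrite !lift_max; exact: lam_mono.
    by rewrite lift_max leqNgt ltn_ord.
  - rewrite big_ord_recr /= /lam' unlift_none addn0.
    by under eq_bigr do rewrite unlift_widen.
  apply: meval_eq => i; rewrite /lam'; case: (unliftP ord_max i) => [j|] ->.
    by rewrite lift_max.
  by rewrite mulr1.
have [r] := set_last_dvd c g; rewrite h0 mwiden0 add0r => g_r.
(* By symmetry, divisibility by the last linear factor passes to every variable. *)
have dvd_g i : i \in index_enum 'I_N.+1 -> exists r, g = ('X_i - c%:MP) * r.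
  move=> _; exists (msym (tperm ord_max i) r).
  rewrite -[g in LHS](issymP _ g_sym (tperm ord_max i)) {1}g_r msymM msymB.
  by rewrite /msym mmapX mmap1U mmapC tpermL.
have [r1 [g_r1 sz_r1]] := dvd_prod_XsubC (index_enum_uniq _) g_nz dvd_g.
have r1_nz : r1 != 0 by apply: contraNneq g_nz; rewrite g_r1 => ->; rewrite mulr0.
have size_enum : size (index_enum 'I_N.+1) = N.+1.
  by rewrite [index_enum _]unlock -enumT size_enum_ord.
rewrite {}size_enum in sz_r1.
(* The nonzero [g] has [N.+1] linear factors and degree at most [k]. *)
have Nk : (N < k)%N.
  by move: g_k; rewrite -sz_r1 (mpolySpred _ r1_nz) addSn ltnS; apply: leq_trans (leq_addl _ _).
case/eqP: r1_nz; apply: (IHk (k - N.+1)%N _ (z * Q)).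
- by rewrite ltn_subrL (leq_trans _ Nk).
- exact: mulf_neq0.
- apply: (@msymMK _ _ (\prod_(i < N.+1) ('X_i - c%:MP))); last by rewrite -g_r1.
    by rewrite prodf_seq_neq0; apply/allP => i _; exact: mpolyXsubC_neq0.
  apply/issymP => s; rewrite rmorph_prod /= [RHS](reindex_inj (@perm_inj _ s)).
  by apply: eq_bigr => i _; rewrite rmorphB /= /msym mmapX mmap1U mmapC.
- by rewrite -subSn // leq_subRL ?(leqW Nk) // addnC sz_r1.
move=> lam lam_mono lam_k.
(* Adding a full column of [N.+1] boxes to [lam] gives a zero of [g]. *)
have /eqP : g.@[fun i => z * T ^- i * Q ^+ (lam i).+1] = 0.
  apply: (g_van (fun i => (lam i).+1)) => [i j /lam_mono //|].
  under eq_bigr do rewrite -addn1; rewrite big_split /= sum_nat_const card_ord muln1.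
  by rewrite addnC -leq_subRL.
rewrite g_r1 mevalM mulf_eq0 => /orP[].
(* A vanishing factor at [i] would mean [Q ^+ (lam i).+1 * T ^+ (N - i) = 1]. *)
- rewrite rmorph_prod prodf_seq_eq0 => /hasP[i _] /=.
  rewrite mevalB mevalXU mevalC subr_eq0 /c -mulrA (inj_eq (mulfI z_nz)) => /eqP e.
  case/eqP: (QT_generic (lam i) (N - i)%N).
  have TN_nz : T ^- N != 0 by rewrite invr_eq0 expf_neq0.
  have iN : (i <= N)%N by rewrite -ltnS.
  apply: (mulfI TN_nz); rewrite mulr1 -[RHS]e mulrCA mulrC; congr (_ * _).
  move: (nat_of_ord i) iN => j jN.
  by rewrite -{1}(subnK jN) exprD invfM mulrAC mulVf ?mul1r ?expf_neq0.
- move=> /eqP r1_0; rewrite -[RHS]r1_0; apply: meval_eq => i.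
  by rewrite exprS -!mulrA; congr (_ * _); rewrite mulrCA.
Qed.

End Interpolation.

(** * Eigenvalues as symmetric polynomials *)

Section GradedPolynomialBasis.
Variables (K : fieldType) (b : nat -> {poly K}).
Hypothesis size_b : forall i, size (b i) = i.+1.

Lemma graded_basis_coef_neq0 n : (b n)`_n != 0.
Proof.
by rewrite -[n in _`_n]/n.+1.-1 -size_b -lead_coefE lead_coef_eq0 -size_poly_eq0 size_b.
Qed.

Lemma graded_basis_expand n (p : {poly K}) : (size p <= n)%N ->
  exists c : nat -> K, p = \sum_(i < n) c i *: b i.
Proof.
elim: n p => [|n IHn] p p_n.
  by exists (fun=> 0); rewrite big_ord0; apply/eqP; rewrite -size_poly_leq0.
(* Chosen so that [d *: b n] cancels the coefficient of degree [n]. *)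
pose d := p`_n / (b n)`_n.
have [|c p_c] := IHn (p - d *: b n).
  apply/leq_sizeP => j; rewrite leq_eqVlt coefB coefZ => /predU1P[<-|nj].
    by rewrite divfK ?subrr // graded_basis_coef_neq0.
  by rewrite !nth_default ?mulr0 ?subr0 ?size_b // (leq_trans p_n).
exists (fun i => if i == n then d else c i); rewrite big_ord_recr /= eqxx.
rewrite -[LHS](subrK (d *: b n)) p_c; congr (_ + _); apply: eq_bigr => i _.
by rewrite ltn_eqF.
Qed.

Lemma graded_basis_free n (c : nat -> K) :
  \sum_(i < n) c i *: b i = 0 -> forall i, (i < n)%N -> c i = 0.
Proof.
elim: n => // n IHn; rewrite big_ord_recr /= => sum0.
have cn0 : c n = 0.
  have := congr1 (fun p : {poly K} => p`_n) sum0.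
  rewrite coefD coefZ coef0 coef_sum big1 => [/eqP|i _]; last first.
    by rewrite coefZ nth_default ?mulr0 // size_b.
  by rewrite add0r mulf_eq0 (negPf (graded_basis_coef_neq0 n)) orbF => /eqP.
move=> i; rewrite ltnS leq_eqVlt => /predU1P[-> //|]; apply: IHn.
by rewrite -[RHS]sum0 cn0 scale0r addr0.
Qed.

End GradedPolynomialBasis.

Section Eigenvalues.
Variables (K : fieldType) (q t : K).
Hypothesis t_neq0 : t != 0.
Hypothesis qt_generic : forall a b, (0 < a + b)%N -> q ^+ a * t ^+ b != 1.
Implicit Types (lam : intpart) (a : nat -> K).

(* [(u; t^-1)_N / (u; t^-1)_k] as a polynomial in [u] *)
Definition qpoch_tail (k N : nat) : {poly K} :=
  \prod_(k <= r < N) (1 - t ^- r *: 'X).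

(** The constant 1 of the expansion serves as the coefficient of index 0, since the expansion puts
    no constraint on [a 0]. *)
Definition ns_coef a (k : nat) : K := if k == 0%N then 1 else a k.

Lemma size_qpoch_factor r : size (1 - t ^- r *: 'X : {poly K}) = 2.
Proof.
have size_ZX : size (- (t ^- r *: 'X) : {poly K}) = 2.
  by rewrite size_polyN size_scale ?size_polyX // invr_eq0 expf_neq0.
by rewrite addrC size_polyDl size_ZX // size_poly1.
Qed.

Lemma qpoch_factor_neq0 r : 1 - t ^- r *: 'X != 0 :> {poly K}.
Proof. by rewrite -size_poly_eq0 size_qpoch_factor. Qed.

Lemma size_qpoch_tail k N : size (qpoch_tail k N) = (N - k).+1.
Proof.
rewrite /qpoch_tail; have [kN|Nk] := leqP k N; last first.
  by rewrite big_geq ?(ltnW Nk) // size_poly1; move/ltnW: Nk => /eqP ->.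
rewrite -{1}(subnKC kN); elim: (N - k)%N => [|d IHd].
  by rewrite addn0 big_geq // size_poly1.
rewrite addnS big_nat_recr ?leq_addr //= size_mul ?qpoch_factor_neq0 //.
  by rewrite IHd size_qpoch_factor addn2.
by rewrite -size_poly_eq0 IHd.
Qed.

Lemma qpoch_tail_split k N : (k <= N)%N ->
  qpoch_tail 0 N = qpochhammer t^-1 k * qpoch_tail k N.
Proof.
move=> kN; rewrite /qpoch_tail (big_cat_nat _ kN) //= big_mkord; congr (_ * _).
by apply: eq_bigr => i _; rewrite exprVn.
Qed.

Lemma horner_qpoch_tail_eq0 k N r :
  (k <= r < N)%N -> (qpoch_tail k N).[t ^+ r] = 0.
Proof.
move=> krN; rewrite /qpoch_tail horner_prod (big_rem r) /= ?mem_index_iota //.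
by rewrite !hornerE mulVf ?expf_neq0 // subrr mul0r.
Qed.

(** A zero at [t ^+ r] would give [t ^+ (s - r) = 1] for some [s >= k > r]. *)
Lemma horner_qpoch_tail_neq0 k N r :
  (r < k)%N -> (qpoch_tail k N).[t ^+ r] != 0.
Proof.
move=> rk; rewrite /qpoch_tail horner_prod prodf_seq_neq0; apply/allP => s /=.
rewrite mem_index_iota => /andP[ks _]; rewrite !hornerE subr_eq0 eq_sym.
have rs := leq_trans rk ks.
have := qt_generic (a := 0) (b := s - r); rewrite add0n subn_gt0 => /(_ rs).
rewrite expr0 mul1r; apply: contra_neq => e.
by rewrite -[LHS]mulr1 -[X in _ * X]e mulrCA -exprD subnK ?(ltnW rs) // mulVf ?expf_neq0.
Qed.

(** Both sides are multiplied by [qpoch_tail 0 N]. The bound [M <= N] makes every denominator divide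
    it, and an empty row contributes its own factor [1 - t ^- i *: 'X]. *)
Lemma ns_expansion_poly lam a M N :
    (size lam <= N)%N -> (forall k, (M < k)%N -> a k = 0) -> (M <= N)%N ->
    \prod_(i < size lam)
       (tofrac ((q ^- nth 0%N lam i)%:P - t ^- i *: 'X) / tofrac (1 - t ^- i *: 'X))
    = 1 + \sum_(1 <= k < M.+1) tofrac (a k)%:P / tofrac (qpochhammer t^-1 k)
      :> {fraction {poly K}} ->
  \prod_(i < N) ((q ^- nth 0%N lam i)%:P - t ^- i *: 'X)
  = \sum_(k < N.+1) ns_coef a k *: qpoch_tail k N.
Proof.
move=> lamN aM MN exp_a; apply/eqP; rewrite -tofrac_eq; apply/eqP.
have -> : tofrac (\prod_(i < N) ((q ^- nth 0%N lam i)%:P - t ^- i *: 'X)) =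
   \prod_(i < size lam) (tofrac ((q ^- nth 0%N lam i)%:P - t ^- i *: 'X)
      / tofrac (1 - t ^- i *: 'X)) * tofrac (qpoch_tail 0 N).
  rewrite /qpoch_tail (big_cat_nat _ lamN) //= big_mkord rmorphM mulrA !rmorph_prod /=.
  rewrite -big_split /=.
  rewrite -(big_mkord xpredT (fun i => tofrac ((q ^- nth 0%N lam i)%:P - t ^- i *: 'X))).
  rewrite (big_cat_nat _ lamN) //= big_mkord; congr (_ * _).
    by apply: eq_bigr => i _; rewrite divfK // tofrac_eq0 qpoch_factor_neq0.
  apply: eq_big_nat => i /andP[lam_i _].
  by rewrite nth_default // expr0 invr1.
rewrite exp_a mulrDl mul1r raddf_sum.
rewrite -(big_mkord xpredT (fun k => tofrac (ns_coef a k *: qpoch_tail k N))) /=.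
rewrite [RHS]big_nat_recl // /ns_coef /= scale1r; congr (_ + _).
rewrite (big_cat_nat _ (_ : (M <= N)%N)) //= [X in _ = _ + X]big_nat_cond.
rewrite [X in _ = _ + X]big1 => [|i /andP[/andP[Mi _] _]]; last first.
  by rewrite aM // scale0r raddf0.
rewrite addr0 big_add1 /= mulr_suml; apply: eq_big_nat => k /andP[_ kM].
rewrite (qpoch_tail_split (leq_trans kM MN)) rmorphM mulrA divfK.
  by rewrite -rmorphM mul_polyC.
by rewrite tofrac_eq0; apply/prodf_neq0 => i _; rewrite exprVn qpoch_factor_neq0.
Qed.

(** At [u = t ^+ k.-1] the product vanishes because row [k.-1] is empty, and the terms of index
    below [k] vanish because their tails contain the factor of index [k.-1]. Those of index above
    [k] are zero by descending induction, so only [a k] times a nonzero value is left. *)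
Lemma ns_expansion_eq0 lam a k :
  ns_expansion q t lam a -> (size lam < k)%N -> a k = 0.
Proof.
case=> M aM exp_a; pose N := maxn M (size lam).
have := ns_expansion_poly (leq_maxr _ _) aM (leq_maxl _ _) exp_a; rewrite -/N => poly_a.
have [d] := ubnP (N - k); elim: d k => // d IHd k; rewrite ltnS => d_k lam_k.
have aN j : (N < j)%N -> a j = 0.
  by move=> Nj; apply: aM; exact: leq_ltn_trans (leq_maxl _ _) Nj.
have [/aN //|kN] := ltnP N k.
have k_gt0 : (0 < k)%N by exact: leq_trans lam_k.
have a0 j : (k < j)%N -> a j = 0.
  move=> kj; have [/aN //|jN] := ltnP N j; apply: IHd; last exact: ltn_trans kj.
  by apply: leq_trans d_k; rewrite ltn_sub2l // (leq_trans kj).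
have := congr1 (fun p => p.[t ^+ k.-1]) poly_a.
have k1N : (k.-1 < N)%N by rewrite prednK.
rewrite horner_prod (bigD1 (Ordinal k1N)) //= nth_default; last first.
  by rewrite -ltnS prednK.
rewrite expr0 invr1 !hornerE mulVf ?expf_neq0 // subrr mul0r.
rewrite horner_sum (bigD1 (Ordinal (kN : (k < N.+1)%N))) //= big1 ?addr0; last first.
  move=> i; rewrite -val_eqE /= neq_ltn hornerZ => /orP[ik|ki].
    by rewrite horner_qpoch_tail_eq0 ?mulr0 // k1N andbT -ltnS prednK.
  by rewrite /ns_coef gtn_eqF ?a0 ?mul0r //; exact: leq_trans ki.
rewrite hornerZ /ns_coef gtn_eqF // => /esym/eqP.
by rewrite mulf_eq0 (negPf (horner_qpoch_tail_neq0 _ _)) ?prednK // orbF => /eqP.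
Qed.

(** Since [a] vanishes beyond [size lam], the bound [M] of the expansion can be replaced by
    [size lam]. *)
Lemma ns_expansion_prod lam a N : ns_expansion q t lam a -> (size lam <= N)%N ->
  \prod_(i < N) ((q ^- nth 0%N lam i)%:P - t ^- i *: 'X)
  = \sum_(k < N.+1) ns_coef a k *: qpoch_tail k N.
Proof.
move=> exp_a lamN; have a0 k := @ns_expansion_eq0 _ _ k exp_a.
case: exp_a => M aM exp_a; apply: (ns_expansion_poly lamN a0 lamN).
have trunc l1 l2 : (l1 <= l2)%N -> (forall k, (l1 < k)%N -> a k = 0) ->
    \sum_(1 <= k < l2.+1) tofrac (a k)%:P / tofrac (qpochhammer t^-1 k)
    = \sum_(1 <= k < l1.+1) tofrac (a k)%:P / tofrac (qpochhammer t^-1 k)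
    :> {fraction {poly K}}.
  move=> l12 al; rewrite (big_cat_nat _ (_ : (l1 < l2.+1)%N)) //=.
  rewrite [X in _ + X]big_nat_cond [X in _ + X]big1 ?addr0 //.
  by move=> k /andP[/andP[l1k _] _]; rewrite al // !rmorph0 mul0r.
rewrite exp_a -(trunc _ _ (leq_maxl M (size lam)) aM).
by rewrite (trunc _ _ (leq_maxr M (size lam)) a0).
Qed.

(** For [N = k], evaluation at [t ^+ k.-1] kills all terms except the last, whose tail is the empty
    product. *)
Lemma ns_expansion_col k a : (0 < k)%N -> ns_expansion q t (colpart k) a ->
  a k = \prod_(i < k) (q^-1 - t ^+ i).
Proof.
move=> k_gt0 exp_a.
have := ns_expansion_prod (N := k) exp_a; rewrite size_nseq => /(_ (leqnn k)).
move=> /(congr1 (fun p => p.[t ^+ k.-1])); rewrite horner_prod horner_sum.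
rewrite [RHS]big_ord_recr /= [X in _ = X + _]big1 => [|i _]; last first.
  by rewrite hornerZ horner_qpoch_tail_eq0 ?mulr0 // -ltnS prednK ?ltn_ord /=.
rewrite add0r hornerZ /qpoch_tail big_geq // hornerC mulr1 /ns_coef gtn_eqF // => <-.
rewrite [RHS](reindex_inj rev_ord_inj) /=; apply: eq_bigr => i _.
rewrite nth_nseq ltn_ord expr1 !hornerE; congr (_ - _).
have ik : (i <= k.-1)%N by rewrite -ltnS prednK.
by rewrite -{1}(subnK ik) exprD mulrCA mulVf ?expf_neq0 // mulr1 -subn1 subnAC subn1 subnS.
Qed.

(** The polynomial [g] is the same for all [lam]. Its degree is at most [k] because the [l]-th
    elementary symmetric polynomial comes with [u^(N-l)], which involves only tails of degree at
    most [N - l], while the tail of index [k] has degree [N - k]. *)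
Lemma ns_eigenvalue_mpoly k N : (0 < k <= N)%N ->
  exists g : {mpoly K[N]},
  [/\ g \is symmetric, (msize g <= k.+1)%N
    & forall lam a, (size lam <= N)%N -> ns_expansion q t lam a ->
        a k = g.@[fun i => t ^+ i * q ^- nth 0%N lam i]].
Proof.
case/andP=> k_gt0 kN.
(* The tails indexed by degree; the powers of ['X] above [N] only complete them to a graded
   basis. *)
pose b i := if (i <= N)%N then qpoch_tail (N - i) N else 'X^i.
have size_b i : size (b i) = i.+1.
  by rewrite /b; case: ifP => [iN|_]; rewrite ?size_polyXn // size_qpoch_tail subKn.
have /choice[phi phiE] j : exists c : nat -> K, 'X^j = \sum_(i < j.+1) c i *: b i.
  by apply: graded_basis_expand; rewrite ?size_polyXn.
(* Coordinates of ['X^j] in the basis [b], extended by zero so that all sums have the same range. *)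
pose psi (j i : nat) := if (i <= j)%N then phi j i else 0.
have psiE j : (j <= N)%N -> 'X^j = \sum_(i < N.+1) psi j i *: b i.
  move=> jN; rewrite phiE -!(big_mkord xpredT (fun i => _ i *: _ i)).
  rewrite [RHS](big_cat_nat _ (_ : (j < N.+1)%N)) //=.
  rewrite [X in _ = _ + X]big_nat_cond [X in _ = _ + X]big1 ?addr0.
    by apply: eq_big_nat => i /andP[_ ij]; rewrite /psi -ltnS ij.
  by move=> i /andP[/andP[ji _] _]; rewrite /psi leqNgt ji scale0r.
(* The leading coefficient in [u] of the product over the rows. *)
pose C : K := (-1) ^+ N * \prod_(i < N) t ^- i.
pose g : {mpoly K[N]} := C *: \sum_(l < N.+1) (psi (N - l)%N (N - k)%N * (-1) ^+ l) *: mesym N K l.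
exists g; split.
- by apply/rpredZ/rpred_sum => l _; apply/rpredZ/mesym_sym.
- apply: leq_trans (msizeZ_le _ _) _; apply: leq_trans (msize_sum _ _ _) _.
  apply/bigmax_leqP => l _; have [lk|kl] := leqP l k.
    apply: leq_trans (msizeZ_le _ _) _; rewrite msizeE.
    apply/bigmax_leqP_seq => m m_l _.
    by rewrite ltnS (dhomog_mf (dhomog_mesym _ _ _) m_l).
  have -> : psi (N - l)%N (N - k)%N = 0.
    by rewrite /psi leqNgt ltn_sub2l //; exact: leq_trans kl (ltn_ord l).
  by rewrite mul0r scale0r msize0.
move=> lam a lamN /ns_expansion_prod-/(_ _ lamN) prodE.
have [y yE] : exists y : N.-tuple K, forall i, tnth y i = t ^+ i * q ^- nth 0%N lam i.
  by exists [tuple t ^+ i * q ^- nth 0%N lam i | i < N] => i; rewrite tnth_mktuple.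
have prodC : \prod_(i < N) ((q ^- nth 0%N lam i)%:P - t ^- i *: 'X) =
    C *: \prod_(c <- y) ('X - c%:P).
  rewrite big_tuple /C -[N in (-1) ^+ N]card_ord -prodrN -scaler_prod.
  apply: eq_bigr => i _; rewrite yE; set x := q ^- _.
  rewrite scaleNr -scalerN opprB scalerBr -[t ^- i *: _%:P]mul_polyC -polyCM.
  by rewrite mulKf // expf_neq0.
have prod_b : \prod_(c <- y) ('X - c%:P) = \sum_(i < N.+1)
    (\sum_(l < N.+1) psi (N - l)%N i * ((-1) ^+ l * (mesym N K l).@[tnth y])) *: b i.
  have size_y : size (\prod_(c <- y) ('X - c%:P)) = N.+1.
    by rewrite size_prod_XsubC size_tuple.
  rewrite -[LHS]coefK size_y poly_def (reindex_inj rev_ord_inj) /=.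
  under [RHS]eq_bigr do rewrite scaler_suml; rewrite exchange_big; apply: eq_bigr => l _.
  rewrite subSS mroots_coeff psiE ?leq_subr // scaler_sumr.
  by apply: eq_bigr => i _; rewrite scalerA mulrC.
have tail_b : \sum_(k < N.+1) ns_coef a k *: qpoch_tail k N =
    \sum_(i < N.+1) ns_coef a (N - i) *: b i.
  rewrite (reindex_inj rev_ord_inj) /=; apply: eq_bigr => i _.
  by rewrite subSS /b -ltnS ltn_ord.
have := prodE; rewrite prodC prod_b tail_b scaler_sumr => /eqP.
rewrite eq_sym -subr_eq0 -sumrB => /eqP sum0.
have := graded_basis_free size_b
  (c := fun i => ns_coef a (N - i) - C * \sum_(l < N.+1)
    psi (N - l)%N i * ((-1) ^+ l * (mesym N K l).@[tnth y])) (n := N.+1).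
move=> /(_ _ (N - k)%N); rewrite ltnS leq_subr subKn // /ns_coef gtn_eqF //.
move=> /(_ _ isT)/eqP; rewrite subr_eq0 => /(_ _)/eqP-> //; last first.
  by rewrite -[RHS]sum0; apply: eq_bigr => i _; rewrite scalerBl scalerA.
rewrite mevalZ rmorph_sum /=; congr (_ * _); apply: eq_bigr => l _.
by rewrite mevalZ mulrA; congr (_ * _); apply: meval_eq => i; rewrite yE.
Qed.
End Eigenvalues.

(** * Partitions of bounded size and the column *)

Section Partitions.
Implicit Types (lam mu : intpart).

Lemma parts_gt0 lam : all (leq 1) lam.
Proof.
case: lam => s s_part /=; case/andP: s_part => _ s0; apply/allP => r rs.
by rewrite lt0n; apply: contraNneq s0 => <-.
Qed.

Lemma leq_size_sumn (s : seq nat) : all (leq 1) s -> (size s <= sumn s)%N.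
Proof. by elim: s => //= r s IHs /andP[r_gt0 /IHs s_le]; rewrite -add1n leq_add. Qed.

Lemma size_sumn_col (s : seq nat) : all (leq 1) s -> (sumn s <= size s)%N -> s = nseq (size s) 1%N.
Proof.
elim: s => //= r s IHs /andP[r_gt0 s_gt0] s_le; have := leq_size_sumn s_gt0.
case: r r_gt0 s_le => [//|r] _; rewrite addSn ltnS => rs_le s_ge.
rewrite -IHs //; last by apply: leq_trans rs_le; exact: leq_addl.
by move: (leq_trans rs_le s_ge); rewrite -{2}[sumn s]add0n leq_add2r leqn0 => /eqP ->.
Qed.

(** All parts are positive, so [k] or more parts with sum at most [k] must be [k] ones. *)
Lemma size_part_lt_col lam k :
  (sumn lam <= k)%N -> lam != colpart k -> (size lam < k)%N.
Proof.
move=> lam_k; apply: contraNT; rewrite -leqNgt => k_lam; apply/eqP/val_inj => /=.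
have := leq_trans (leq_size_sumn (parts_gt0 lam)) lam_k => lam_k'.
have size_lam : size lam = k by apply/eqP; rewrite eqn_leq lam_k'.
by rewrite -size_lam -size_sumn_col ?parts_gt0 // size_lam.
Qed.

(** Links the evaluation points of [interpolation_unique], given by functions on rows, to the
    partitions in the definition of shifted Macdonald polynomials. *)
Lemma intpart_of_fun N (mu : 'I_N -> nat) :
    {homo mu : i j / (i <= j)%N >-> (j <= i)%N} ->
  exists lam : intpart, [/\ (size lam <= N)%N, sumn lam = (\sum_i mu i)%N
    & forall i : 'I_N, nth 0%N lam i = mu i].
Proof.
move=> mu_mono; pose s := [seq mu i | i <- enum 'I_N].
have s_sorted : sorted geq s.
  rewrite sorted_map; apply: (@sub_sorted _ (relpre val leq)) => [i j|].
    exact: mu_mono.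
  by rewrite -sorted_map val_enum_ord iota_sorted.
have {s_sorted mu_mono} [lam [lam_part [e lam_e]]] :
    exists s' : seq nat, is_part s' /\ exists e, s = s' ++ nseq e 0%N.
  exists [seq r <- s | r != 0%N]; split.
    rewrite /is_part sorted_filter ?mem_filter //.
    by move=> x y z; move=> xy yz; exact: leq_trans yz xy.
  elim: s s_sorted => [|r s IHs] /=; first by exists 0%N.
  move=> rs_path; have [e s_e] := IHs (path_sorted rs_path).
  case: r rs_path => [|r] rs_path /=; last by exists e; rewrite {1}s_e.
  exists (size s).+1; have s0 : all (pred1 0%N) s.
    apply/allP => x xs; have := order_path_min _ rs_path => /(_ _)/allP/(_ _ xs).
    by rewrite /= leqn0; apply=> ? ? ? h1 h2; exact: leq_trans h2 h1.
  have -> : [seq r <- s | r != 0%N] = [::].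
    apply/eqP; rewrite -size_eq0 size_filter -leqn0 leqNgt -has_count -all_predC.
    by apply: sub_all s0 => x /= ->.
  by rewrite {1}(all_pred1P _ _ s0).
exists (IntPart lam_part); split => /=.
- by have := congr1 size lam_e; rewrite size_map size_enum_ord size_cat => ->; exact: leq_addr.
- have := congr1 sumn lam_e; rewrite sumn_cat sumn_nseq mul0n addn0 => <-.
  by rewrite sumnE big_map big_enum.
- move=> i; have := congr1 (fun s => nth 0%N s i) lam_e.
  rewrite (nth_map i) ?size_enum_ord // nth_ord_enum nth_cat nth_nseq if_same => ->.
  by case: ltnP => // /(nth_default _) ->.
Qed.

Lemma conj_part_col k : (0 < k)%N -> conj_part (nseq k 1%N) = [:: k].
Proof. by case: k => //= k _; rewrite /conj_part /mkseq /= count_nseq mul1n. Qed.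

Lemma nstat_col k : nstat (nseq k 1%N) = 'C(k, 2).
Proof.
rewrite /nstat -bin2_sum big_mkord size_nseq; apply: eq_bigr => i _.
by rewrite nth_nseq ltn_ord muln1.
Qed.

(** The box in row [i] has arm 0 and leg [k - i.+1]; the product is taken in reverse order. *)
Lemma cup_col (K : fieldType) (Q T : K) k :
  (0 < k)%N -> cup Q T (nseq k 1%N) = \prod_(i < k) (1 - Q * T ^+ i).
Proof.
move=> k_gt0; rewrite /cup size_nseq [RHS](reindex_inj rev_ord_inj) /=.
apply: eq_bigr => i _; rewrite nth_nseq ltn_ord big_ord1 /arm /leg nth_nseq ltn_ord.
by rewrite conj_part_col // subnn expr1.
Qed.

End Partitions.

(** * Eigenvalues as values of the column shifted Macdonald polynomial *)

Section ShiftedMacdonaldColumn.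
Variables (K : fieldType) (q t : K).
Hypotheses (q_neq0 : q != 0) (t_neq0 : t != 0).
Hypothesis qt_generic : forall a b, (0 < a + b)%N -> q ^+ a * t ^+ b != 1.

Lemma ns_expansion_shifted_macdonald (a : nat -> intpart -> K)
    (a_def : forall lam, ns_expansion q t lam (fun k => a k lam))
    (k : nat) (k_gt0 : (0 < k)%N) (f : mpfam K)
    (f_def : shifted_macdonald q^-1 t^-1 (colpart k) f) (lam : intpart) :
  a k lam = t ^- 'C(k, 2) * shifted_eval q^-1 (colpart k) f lam.
Proof.
rewrite /shifted_eval [size (colpart k)]size_nseq.
set N := maxn k (size lam); case: f_def => _ /(_ N).
rewrite size_nseq => /(_ (leq_maxl _ _))[f_k [g g_sym f_g] f_van f_col].
have sumn_col : sumn (colpart k) = k by rewrite sumn_nseq mul1n.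
(* The shift by [T ^- i] turns the point [Q^mu] into the variables [y_i] of the eigenvalue
   polynomial. *)
have fE (mu : intpart) : (f N).@[qpoint q^-1 mu (N := N)] =
    g.@[fun i => t ^+ i * q ^- nth 0%N mu i].
  rewrite f_g comp_mpoly_meval; apply: meval_eq => i.
  by rewrite tnth_mktuple mevalZ mevalXU /qpoint !exprVn invrK.
have g_k : (msize g <= k.+1)%N.
  rewrite -sumn_col; apply: leq_trans f_k; rewrite f_g msize_scale_vars // => i.
  by rewrite invr_eq0 expf_neq0 // invr_eq0.
have kN : (0 < k <= N)%N by rewrite k_gt0 leq_maxl.
have [h [h_sym h_k hE]] := ns_eigenvalue_mpoly t_neq0 qt_generic kN.
pose D := h - t ^- 'C(k, 2) *: g.
have DE (mu : intpart) : (size mu <= N)%N -> a k mu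
    = D.@[fun i => t ^+ i * q ^- nth 0%N mu i]
      + t ^- 'C(k, 2) * (f N).@[qpoint q^-1 mu (N := N)].
  by move=> mu_N; rewrite mevalB mevalZ fE subrK (hE _ _ mu_N (a_def mu)).
suff D0 : D = 0 by rewrite (DE lam) ?leq_maxr // D0 meval0 add0r.
apply: (@interpolation_unique _ q^-1 t^-1 _ _ N k 1).
- by rewrite invr_eq0.
- move=> i j; rewrite !exprVn -invfM invr_eq1.
  exact: qt_generic.
- exact: oner_neq0.
- by rewrite invr_eq0.
- by apply: rpredB => //; exact: rpredZ.
- apply: leq_trans (msizeD_le _ _) _; rewrite geq_max h_k msizeN.
  exact: leq_trans (msizeZ_le _ _) _.
move=> mu mu_mono mu_k; have [nu [nu_N nu_mu nuE]] := intpart_of_fun mu_mono.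
have -> : D.@[fun i => 1 * t^-1 ^- i * q^-1 ^+ mu i] =
    D.@[fun i => t ^+ i * q ^- nth 0%N nu i].
  by apply: meval_eq => i; rewrite mul1r !exprVn invrK nuE.
have := DE nu nu_N; rewrite -nu_mu in mu_k.
have [nu_col|nu_ncol] := eqVneq nu (colpart k); last first.
  (* Away from the column, both polynomials vanish: [mu] has fewer than [k] rows. *)
  rewrite f_van ?sumn_col // mulr0 addr0 => <-.
  by apply: (ns_expansion_eq0 t_neq0 qt_generic (a_def nu)); exact: size_part_lt_col.
rewrite {1}nu_col (ns_expansion_col t_neq0 qt_generic k_gt0 (a_def _)) {2}nu_col f_col.
rewrite sumn_col [part _]/= conj_part_col // nstat_col cup_col //.
have -> : nstat [:: k] = 0%N by rewrite /nstat big_ord1.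
set X := \prod_(i < k) _; set Y := t ^- _ * _; suff -> : Y = X.
  by rewrite -{1}[X]add0r => /addIr <-.
rewrite {}/Y {}/X.
(* The normalization contributes [t ^+ (2 * 'C(k, 2))], half of which cancels. Distributing the rest
   and the sign over the rows turns [1 - q^-1 * t ^- i] into [q^-1 - t ^+ i]. *)
rewrite expr0 mulr1 exprVn invrK mul2n -addnn exprD !mulrA [_ * (-1) ^+ _]mulrC divfK ?expf_neq0 //.
rewrite -bin2_sum big_mkord -prodrXr -[k in (-1) ^+ k]card_ord -prodrN -big_split /=.
apply: eq_bigr => i _; rewrite mulNr mulrBr mulr1 opprB mulrCA exprVn mulfV ?expf_neq0 //.
by rewrite mulr1.
Qed.

End ShiftedMacdonaldColumn.

(** * Bases unitriangular for the dominance order *)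

Section PartitionRank.
Implicit Types (lam mu : intpart).

(* A linear refinement of the dominance order among partitions of a given size. *)
Definition dom_rank lam : nat := (\sum_(i < (sumn lam).+1) sumn (take i lam))%N.

Lemma sumn_take_leq (s : seq nat) i : (sumn (take i s) <= sumn s)%N.
Proof. by rewrite -[s in leqRHS](cat_take_drop i) sumn_cat leq_addr. Qed.

(** [dominated] tests prefixes up to [size mu]; beyond that, the prefix sums of [mu] are constant
    and those of [lam] do not decrease. *)
Lemma dominated_take mu lam i :
  dominated mu lam -> (sumn (take i mu) <= sumn (take i lam))%N.
Proof.
case/andP=> /eqP mu_lam /forallP le_take; have [i_mu|mu_i] := ltnP i (size mu).+1.
  exact: (le_take (Ordinal i_mu)).
have := le_take ord_max; rewrite /= take_size => mu_le.
rewrite (@take_oversize _ i) ?(ltnW mu_i) //; apply: leq_trans mu_le _.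
by rewrite -(@take_takel _ _ i lam (ltnW mu_i)) sumn_take_leq.
Qed.

Lemma size_part_le lam mu :
  (forall i, (i <= sumn mu)%N -> sumn (take i lam) = sumn (take i mu)) ->
  sumn mu = sumn lam -> (size lam <= size mu)%N.
Proof.
move=> eq_take mu_lam; have := eq_take (size mu) (leq_size_sumn (parts_gt0 mu)).
rewrite take_size mu_lam -{2}(cat_take_drop (size mu) lam) sumn_cat.
rewrite -{1}[sumn (take _ _)]addn0 => /addnI/esym drop0.
have := leq_size_sumn (s := drop (size mu) lam).
rewrite drop0 size_drop leqn0 subn_eq0; apply.
by have := parts_gt0 lam; rewrite -{1}(cat_take_drop (size mu) lam) all_cat => /andP[].
Qed.

(** The prefix sums compare term by term, so equal ranks would make them all equal, which determines
    the lengths and then the parts. *)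
Lemma dom_rank_lt mu lam : dominated mu lam -> mu != lam -> (dom_rank mu < dom_rank lam)%N.
Proof.
move=> mu_lam; apply: contraNT; rewrite -leqNgt => rank_le.
have sum_eq : sumn mu = sumn lam by case/andP: mu_lam => /eqP.
have leif i : true -> (sumn (take i mu) <= sumn (take i lam)
    ?= iff (sumn (take i mu) == sumn (take i lam)))%N.
  by move=> _; split=> //; exact: dominated_take.
have := leqif_sum (fun i : 'I_(sumn lam).+1 => leif i).
rewrite /dom_rank sum_eq in rank_le * => -[rank_ge]; rewrite eqn_leq rank_ge rank_le.
move=> /esym/forallP eq_take_ord.
have eq_take i : (i <= sumn lam)%N -> sumn (take i mu) = sumn (take i lam).
  by rewrite -ltnS => i_n; apply/eqP; have := eq_take_ord (Ordinal i_n).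
have size_eq : size mu = size lam.
  apply/eqP; rewrite eqn_leq !size_part_le // => i; rewrite ?sum_eq => i_n.
  by rewrite eq_take.
apply/eqP/val_inj/(@eq_from_nth _ 0%N) => //= i i_mu.
have i_lam : (i < size lam)%N by rewrite -size_eq.
have iS := leq_trans i_lam (leq_size_sumn (parts_gt0 lam)).
have := eq_take i.+1 iS; rewrite !(take_nth 0%N) // !sumn_rcons eq_take ?(ltnW iS) //.
exact: addnI.
Qed.

End PartitionRank.

(** * Coordinates in a free family *)

Section FreeFamilies.
Variables (K : fieldType) (b : intpart -> symfun K).

Definition free_family := forall (s : seq intpart) (c : intpart -> K),
  uniq s -> \sum_(lam <- s) c lam *: b lam = 0 -> {in s, forall lam, c lam = 0}.

Lemma big_finsupp (V : zmodType) (d : {fsfun intpart -> K with 0}) (s : seq intpart)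
    (G : intpart -> V) : uniq s -> {subset finsupp d <= s} ->
    (forall lam, d lam = 0 -> G lam = 0) ->
  \sum_(lam <- finsupp d) G lam = \sum_(lam <- s) G lam.
Proof.
move=> s_uniq d_s G0; rewrite [RHS](bigID (fun lam => lam \in finsupp d)) /=.
rewrite [X in _ = _ + X]big1 ?addr0 => [|lam lam_d]; last by rewrite G0 ?fsfun_dflt.
rewrite -[RHS]big_filter; apply/perm_big/uniq_perm; rewrite ?filter_uniq ?fset_uniq //.
by move=> lam; rewrite mem_filter andb_idr //; exact: d_s.
Qed.

Hypothesis b_free : free_family.

(** The given combination shows that the choice made in [coord] is over a nonempty set; freeness
    then identifies the chosen coordinates with the given ones. *)
Lemma coord_sum (s : seq intpart) (c : intpart -> K) lam : uniq s ->
  Defs.coord b (\sum_(mu <- s) c mu *: b mu) lam = if lam \in s then c lam else 0.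
Proof.
move=> s_uniq; set f := \sum_(mu <- s) _.
pose d : {fsfun intpart -> K with 0} := [fsfun mu in seq_fset tt s => c mu | 0].
have dE mu : d mu = if mu \in s then c mu else 0.
  by rewrite fsfunE seq_fsetE.
have f_d : f = \sum_(mu <- finsupp d) d mu *: b mu.
  rewrite (big_finsupp s_uniq) => [|mu|mu ->]; last by rewrite scale0r.
    by apply: eq_big_seq => mu mu_s; rewrite dE mu_s.
  by rewrite mem_finsupp dE; case: ifP => //; rewrite eqxx.
have f_c : f = \sum_(mu <- finsupp (Defs.coord b f)) Defs.coord b f mu *: b mu.
  by have := @xgetPex _ [fsfun] [set c : {fsfun intpart -> K with 0} |
    f = \sum_(mu <- finsupp c) c mu *: b mu]%classic (ex_intro _ d f_d).
rewrite -dE; set e := Defs.coord b f in f_c *.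
pose r := undup (finsupp d ++ finsupp e).
have d_r : {subset finsupp d <= r} by move=> mu; rewrite mem_undup mem_cat => ->.
have e_r : {subset finsupp e <= r} by move=> mu; rewrite mem_undup mem_cat orbC => ->.
have r_uniq : uniq r := undup_uniq _.
have := f_c; rewrite f_d (big_finsupp r_uniq d_r) => [|mu ->]; last by rewrite scale0r.
rewrite (big_finsupp r_uniq e_r) => [/eqP|mu ->]; last by rewrite scale0r.
rewrite -subr_eq0 -sumrB => /eqP sum0.
have de := @b_free r (fun mu => d mu - e mu) r_uniq.
have [lam_r|] := boolP (lam \in r).
  apply/esym/eqP; rewrite -subr_eq0; apply/eqP/de => //.
  by rewrite -[RHS]sum0; apply: eq_bigr => mu _; rewrite scalerBl.
by rewrite mem_undup mem_cat negb_or => /andP[lam_d lam_e]; rewrite !fsfun_dflt.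
Qed.

Lemma ns_operator_sum (a : nat -> intpart -> K) k (s : seq intpart) (c : intpart -> K) :
    uniq s ->
  ns_operator b a k (\sum_(mu <- s) c mu *: b mu)
    = \sum_(mu <- s) (c mu * a k mu) *: b mu.
Proof.
move=> s_uniq; rewrite /ns_operator (big_finsupp s_uniq) => [|mu|mu ->].
- by apply: eq_big_seq => mu mu_s; rewrite coord_sum // mu_s.
- by rewrite mem_finsupp coord_sum //; case: ifP => //; rewrite eqxx.
- by rewrite mul0r scale0r.
Qed.

End FreeFamilies.

(** * Monomial coefficients of symmetric functions *)

Section SymmetricCoefficients.
Variable K : fieldType.
Implicit Types (f : symfun K) (lam mu : intpart).

Lemma symfun_sumE (I : Type) (s : seq I) (C : pred I) (F : I -> symfun K) N :
  val (\sum_(i <- s | C i) F i) N = \sum_(i <- s | C i) val (F i) N.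
Proof.
elim/big_rec2: _ => [|i y x _ <-]; first by rewrite raddf0.
by rewrite raddfD.
Qed.

Lemma symfun_addE f g N : val (f + g) N = val f N + val g N.
Proof. by rewrite raddfD. Qed.

(** Compatibility with setting the last variable to 0 adds one zero exponent at a time. *)
Lemma symfun_coef_pad f N M (m : 'X_{1..N}) : (N <= M)%N ->
  exists m' : 'X_{1..M}, (val f N)@_m = (val f M)@_m'
    /\ m' = m ++ nseq (M - N) 0%N :> seq nat.
Proof.
have /asboolP[_ f_stab _] := symfunP f.
elim: M => [|M IHM] NM; first by move: NM m; rewrite leqn0 => /eqP-> m; exists m; rewrite cats0.
move: NM; rewrite leq_eqVlt => /predU1P[NM|NM].
  by rewrite -NM subnn; exists m; rewrite cats0.
have [m' [-> m'_m]] := IHM NM; exists (mnmwiden m'); split.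
  by rewrite -set_last0_coef f_stab.
by rewrite /= m'_m subSn // rcons_cat -[in RHS]addn1 nseqD cats1.
Qed.

Lemma perm_filter_neq0 (s : seq nat) :
  perm_eq s ([seq e <- s | e != 0%N] ++ nseq (size s - size [seq e <- s | e != 0%N]) 0%N).
Proof.
rewrite perm_sym -(perm_size (permEl (perm_filterC (fun e => e != 0%N) s))) size_cat.
rewrite addKn; have /all_pred1P <- : all (pred1 0%N) [seq e <- s | predC (fun e => e != 0%N) e].
  by apply/allP => e; rewrite mem_filter /= negbK => /andP[].
exact/permEl/perm_filterC.
Qed.

(** Padded to a common number of variables, the two exponent vectors are permutations of each other,
    and [f] is symmetric. *)
Lemma symfun_coef_perm f N N' (m : 'X_{1..N}) (m' : 'X_{1..N'}) :
    perm_eq [seq e <- m | e != 0%N] [seq e <- m' | e != 0%N] ->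
  (val f N)@_m = (val f N')@_m'.
Proof.
move=> mm'; have /asboolP[f_sym _ _] := symfunP f.
have [p [-> p_m]] := symfun_coef_pad f m (leq_maxl N N').
have [p' [-> p'_m']] := symfun_coef_pad f m' (leq_maxr N N').
have : perm_eq p p'.
  apply: perm_trans (perm_filter_neq0 p) _.
  rewrite perm_sym; apply: perm_trans (perm_filter_neq0 p') _.
  have fnz (s : seq nat) d : [seq e <- s ++ nseq d 0%N | e != 0%N] = [seq e <- s | e != 0%N].
    by rewrite filter_cat; elim: d => [|d IHd] //=; rewrite cats0.
  rewrite p_m p'_m' !fnz !size_cat !size_nseq !size_tuple.
  rewrite !subnKC ?leq_maxl ?leq_maxr // (perm_size mm').
  by rewrite perm_cat2r perm_sym.
move=> /tuple_permP[s p_s]; rewrite -(msym_coeff p' s (f_sym _)).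
congr (_@__); apply/mnmP => i; rewrite mnmE; apply/esym.
by rewrite (mnm_nth 0%N p) p_s -tnth_nth tnth_mktuple.
Qed.

(** The coordinate on [msymf lam], read off in the least number of variables where the monomial of
    [lam] occurs. *)
Definition part_coef lam f : K := (val f (size lam))@_(Multinom (in_tuple lam)).

Lemma part_coef_sum lam (I : Type) (s : seq I) (c : I -> K) (F : I -> symfun K) :
  part_coef lam (\sum_(i <- s) c i *: F i) = \sum_(i <- s) c i * part_coef lam (F i).
Proof.
rewrite /part_coef symfun_sumE raddf_sum; apply: eq_bigr => i _ /=.
by rewrite mcoeffZ.
Qed.

Lemma part_coefD lam f g : part_coef lam (f + g) = part_coef lam f + part_coef lam g.
Proof. by rewrite /part_coef symfun_addE mcoeffD. Qed.

Lemma filter_part lam : [seq e <- lam | e != 0%N] = lam :> seq nat.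
Proof. by apply/all_filterP; apply: sub_all (parts_gt0 lam) => r; rewrite lt0n. Qed.

Lemma perm_part lam mu : perm_eq lam mu = (lam == mu).
Proof.
apply/idP/eqP => [lam_mu|-> //]; apply/val_inj/(@sorted_eq _ geq _ _ _ _ _ _ lam_mu).
- by move=> x y z xy yz; exact: leq_trans yz xy.
- by move=> x y; rewrite andbC; exact: anti_leq.
- by have /andP[] := partP lam.
- by have /andP[] := partP mu.
Qed.

Lemma part_coef_msymf lam mu : part_coef lam (msymf mu) = (lam == mu)%:R.
Proof. by rewrite /part_coef /= monosym_coef /= filter_part perm_part. Qed.

Lemma mdeg_filter_neq0 N (m : 'X_{1..N}) : sumn [seq e <- m | e != 0%N] = mdeg m.
Proof.
rewrite /mdeg sumnE big_filter big_mkcond; apply: eq_bigr => e _.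
by case: eqP.
Qed.

Lemma homogeneous_msymf lam : homogeneous (sumn lam) (msymf lam : symfun K).
Proof.
move=> N; apply/dhomogP => m; rewrite mcoeff_msupp monosym_coef.
case: (boolP (perm_eq _ _)) => [/perm_sumn e _|_]; last by rewrite eqxx.
exact: etrans (esym (mdeg_filter_neq0 m)) e.
Qed.

Lemma homogeneous_expand n f : homogeneous n f ->
  f = \sum_(lam <- partitions n) part_coef lam f *: msymf lam.
Proof.
move=> f_n; apply/val_inj/functional_extensionality_dep => N; apply/mpolyP => m.
rewrite symfun_sumE raddf_sum /=.
under eq_bigr do rewrite mcoeffZ monosym_coef.
have [m_n|m_n] := eqVneq (mdeg m) n; last first.
  rewrite (dhomog_nemf_coeff (f_n N) m_n) big_seq big1 // => lam.
  rewrite mem_partitions => /eqP lam_n; case: (boolP (perm_eq _ _)); last by rewrite mulr0.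
  by move/perm_sumn; rewrite mdeg_filter_neq0 lam_n => /eqP; rewrite (negPf m_n).
have m_part : is_part (sort geq [seq e <- m | e != 0%N]).
  rewrite /is_part mem_sort mem_filter andbT.
  by apply: sort_sorted => x y; exact: leq_total.
(* The only partition whose monomial function contains [m]. *)
pose lam0 := IntPart m_part.
have m_lam0 : perm_eq [seq e <- m | e != 0%N] lam0 by rewrite perm_sym perm_sort.
have lam0_n : lam0 \in partitions n.
  by rewrite mem_partitions -(perm_sumn m_lam0) mdeg_filter_neq0 m_n.
rewrite (bigD1_seq lam0) ?partitions_uniq //= m_lam0 mulr1 big1 ?addr0.
  by apply: symfun_coef_perm; rewrite filter_part.
move=> lam lam_lam0; case: (boolP (perm_eq _ _)); last by rewrite mulr0.
move=> m_lam; case/eqP: lam_lam0; apply/eqP; rewrite -perm_part perm_sym.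
by rewrite -(permPl m_lam0).
Qed.

End SymmetricCoefficients.

(** * Unitriangular families as bases *)

Section UnitriangularFamilies.
Variables (K : fieldType) (P : intpart -> symfun K).
Hypothesis P_unitriangular : forall lam, exists u : intpart -> K,
  P lam = msymf lam
    + \sum_(mu <- partitions (sumn lam) | (mu != lam) && dominated mu lam) u mu *: msymf mu.

Lemma part_coef_unitriangular lam : part_coef lam (P lam) = 1.
Proof.
have [u ->] := P_unitriangular lam; rewrite part_coefD -big_filter part_coef_sum.
rewrite part_coef_msymf eqxx big_seq big1 ?addr0 // => mu.
rewrite mem_filter part_coef_msymf eq_sym => /andP[/andP[/negPf-> _] _].
by rewrite mulr0.
Qed.

Lemma part_coef_neq0_rank lam mu :
  mu != lam -> part_coef mu (P lam) != 0 -> (dom_rank mu < dom_rank lam)%N.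
Proof.
move=> mu_lam; have [u ->] := P_unitriangular lam.
rewrite part_coefD -big_filter part_coef_sum part_coef_msymf (negPf mu_lam) add0r.
apply: contraR => mu_rank; rewrite big_seq big1 // => nu.
rewrite mem_filter part_coef_msymf => /andP[/andP[nu_lam nu_dom] _].
case: eqVneq => [mu_nu|_]; last by rewrite mulr0.
by rewrite mu_nu dom_rank_lt in mu_rank.
Qed.

(** Descending induction on [dom_rank]: in the coefficient at [lam], any other contributing [P mu]
    has larger rank, so its [c mu] is already zero. *)
Lemma unitriangular_free : free_family P.
Proof.
move=> s c s_uniq sum0; pose M := (\max_(lam <- s) dom_rank lam)%N.
move=> lam; have [d] := ubnP (M - dom_rank lam); elim: d lam => // d IHd lam.
rewrite ltnS => lam_d lam_s; have := congr1 (part_coef lam) sum0.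
rewrite part_coef_sum (bigD1_seq lam) //= part_coef_unitriangular mulr1 big1_seq; last first.
  move=> mu /andP[mu_lam mu_s]; have [->|mu_coef] := eqVneq (part_coef lam (P mu)) 0.
    by rewrite mulr0.
  have mu_rank : (dom_rank lam < dom_rank mu)%N.
    by apply: part_coef_neq0_rank mu_coef; rewrite eq_sym.
  rewrite IHd ?mul0r //; apply: leq_trans lam_d; apply: ltn_sub2l => //.
  by apply: leq_trans mu_rank _; rewrite /M (bigD1_seq mu) //= leq_maxl.
by rewrite addr0 => ->; rewrite /part_coef raddf0.
Qed.

Definition in_span n (f : symfun K) :=
  exists c : intpart -> K, f = \sum_(lam <- partitions n) c lam *: P lam.

Lemma in_span_sum n (I : eqType) (s : seq I) (c : I -> K) (F : I -> symfun K) :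
  {in s, forall i, in_span n (F i)} -> in_span n (\sum_(i <- s) c i *: F i).
Proof.
elim: s => [|i s IHs] F_n.
  by exists (fun=> 0); rewrite big_nil big1 // => lam _; rewrite scale0r.
have [c1 F_c1] := F_n i (mem_head _ _).
have [|c2 F_c2] := IHs; first by move=> j js; apply: F_n; rewrite inE js orbT.
exists (fun lam => c i * c1 lam + c2 lam); rewrite big_cons F_c1 F_c2 scaler_sumr.
by rewrite -big_split; apply: eq_bigr => lam _; rewrite scalerDl scalerA.
Qed.

Lemma msymf_in_span (lam : intpart) : in_span (sumn lam) (msymf lam).
Proof.
have [d] := ubnP (dom_rank lam); elim: d lam => // d IHd lam; rewrite ltnS => lam_d.
have [u P_u] := P_unitriangular lam.
have [|c c_u] := @in_span_sum (sumn lam) _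
  [seq mu <- partitions (sumn lam) | (mu != lam) && dominated mu lam] u msymf.
  move=> mu; rewrite mem_filter mem_partitions => /andP[/andP[mu_lam mu_dom] /eqP <-].
  by apply: IHd; apply: leq_trans (dom_rank_lt _ _) lam_d.
rewrite big_filter in c_u.
(* Solves the unitriangular relation for [msymf lam], the terms of lower rank being known by
   induction. *)
exists (fun mu => (mu == lam)%:R - c mu).
rewrite (eq_bigr (fun mu => (mu == lam)%:R *: P mu - c mu *: P mu)) => [|mu _]; last first.
  by rewrite scalerBl.
rewrite sumrB -c_u (bigD1_seq lam) ?partitions_uniq ?mem_partitions //= eqxx scale1r.
rewrite big1 => [|mu /negPf->]; last by rewrite scale0r.
by rewrite addr0 [X in X - _]P_u addrK.
Qed.

Lemma homogeneous_in_span n f : homogeneous n f -> in_span n f.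
Proof.
move=> /homogeneous_expand ->; apply: in_span_sum => lam; rewrite mem_partitions.
by move=> /eqP <-; exact: msymf_in_span.
Qed.

Lemma homogeneous_unitriangular (lam : intpart) : homogeneous (sumn lam) (P lam).
Proof.
move=> N; have [u ->] := P_unitriangular lam; rewrite symfun_addE symfun_sumE.
apply: rpredD; first exact: homogeneous_msymf.
rewrite big_seq_cond; apply: rpred_sum => mu /andP[].
rewrite mem_partitions => /eqP <- _; apply: rpredZ; exact: homogeneous_msymf.
Qed.

End UnitriangularFamilies.

(** * The series *)

Section NazarovSklyaninSeries.
Variables (K : fieldType) (q t : K) (P : intpart -> symfun K).
Hypothesis P_unitriangular : forall lam, exists u : intpart -> K,
  P lam = msymf lam
    + \sum_(mu <- partitions (sumn lam) | (mu != lam) && dominated mu lam) u mu *: msymf mu.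
Hypothesis clow_neq0 : forall lam : intpart, clow q t lam != 0.

Lemma ns_operator_eigen (a : nat -> intpart -> K) k lam :
  ns_operator P a k (P lam) = a k lam *: P lam.
Proof.
have := ns_operator_sum (unitriangular_free P_unitriangular) a k
  (s := [:: lam]) (fun=> 1) isT.
by rewrite !big_seq1 scale1r mul1r.
Qed.

Lemma Jint_free : free_family (Jint q t P).
Proof.
move=> s c s_uniq sum0 lam lam_s.
have := @unitriangular_free _ _ P_unitriangular s (fun lam => c lam * clow q t lam) s_uniq.
have -> : \sum_(lam <- s) (c lam * clow q t lam) *: P lam = 0.
  by rewrite -[RHS]sum0; apply: eq_bigr => mu _; rewrite scalerA.
by move=> /(_ erefl lam lam_s)/eqP; rewrite mulf_eq0 (negPf (clow_neq0 _)) orbF => /eqP.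
Qed.

(** If [F n] has coordinates [c] in [P], its product with [P mu] is
    [(c mu * cup q t mu / n!) *: P mu]: the factors [clow] from the two coordinates cancel against
    those of [jnorm] and [Jint]. This must equal [a k mu *: P mu]. *)
Lemma ns_series_expand (a : nat -> intpart -> K) (k n : nat) (F : nat -> symfun K) :
    (forall lam : intpart, cup q t lam != 0) -> n`!%:R != 0 :> K ->
    ns_series q t P a k F -> (k <= n)%N ->
  (n`!%:R : K)^-1 *: F n = \sum_(lam <- partitions n) (a k lam / cup q t lam) *: P lam.
Proof.
move=> cup_neq0 fact_neq0 [F_hom _ F_times] kn.
have [c F_c] := homogeneous_in_span P_unitriangular (F_hom n).
rewrite F_c scaler_sumr; apply: eq_big_seq => mu; rewrite mem_partitions => /eqP mu_n.
rewrite scalerA; congr (_ *: _).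
have mu_hom := homogeneous_unitriangular P_unitriangular mu; rewrite mu_n in mu_hom.
have F_J : F n = \sum_(lam <- partitions n) (c lam / clow q t lam) *: Jint q t P lam.
  by rewrite F_c; apply: eq_bigr => lam _; rewrite scalerA divfK.
have P_J : P mu = \sum_(lam <- [:: mu]) (clow q t lam)^-1 *: Jint q t P lam.
  by rewrite big_seq1 scalerA mulVf ?scale1r.
have := F_times n kn _ mu_hom; rewrite ns_operator_eigen /times_qt.
have mu_in : mu \in partitions n by rewrite mem_partitions mu_n.
rewrite (bigD1_seq mu) ?partitions_uniq //= big1 => [|lam lam_mu]; last first.
  by rewrite [P mu]P_J (coord_sum Jint_free) // inE (negPf lam_mu) mulr0 mul0r scale0r.
rewrite addr0 F_J P_J !(coord_sum Jint_free) ?partitions_uniq // mu_in mem_head -P_J.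
(* Both sides are multiples of [P mu], whose coefficient at [mu] is 1. *)
rewrite scalerA => /(congr1 (part_coef mu)).
have part_coefZ d : part_coef mu (d *: P mu) = d.
  have := part_coef_sum mu [:: mu] (fun=> d) P.
  by rewrite !big_seq1 part_coef_unitriangular // mulr1.
rewrite !part_coefZ /jnorm => <-.
by field; rewrite cup_neq0 clow_neq0 fact_neq0.
Qed.

End NazarovSklyaninSeries.

(** * Genericity of the indeterminates [q] and [t] *)

Section GenericParameters.

Lemma qX_tX a b : q ^+ a * t ^+ b = tofrac ('X_ord0 ^+ a * 'X_ord_max ^+ b : {mpoly rat[2]}).
Proof. by rewrite rmorphM !rmorphXn. Qed.

(** The monomial has total degree [a + b], hence differs from the constant 1. *)
Lemma qt_generic a b : (0 < a + b)%N -> q ^+ a * t ^+ b != 1.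
Proof.
move=> ab_gt0; rewrite qX_tX -tofrac1 tofrac_eq.
rewrite !mpolyXn -mpolyXD -mpolyX0; apply: contraTneq ab_gt0 => /(congr1 (fun p => msize p)).
by rewrite !msizeX mdegD !mdegMn !mdeg1 !mul1n mdeg0 => -[->].
Qed.

Lemma q_neq0 : q != 0.
Proof. by rewrite tofrac_eq0 -msize_poly_eq0 msizeX. Qed.

Lemma t_neq0 : t != 0.
Proof. by rewrite tofrac_eq0 -msize_poly_eq0 msizeX. Qed.

Lemma natr_Qqt_neq0 n : (0 < n)%N -> n%:R != 0 :> Qqt.
Proof.
move=> n_gt0; rewrite -tofrac1 -tofracMn tofrac_eq0 -(rmorph_nat (@mpolyC 2 rat)).
by rewrite mpolyC_eq Num.Theory.pnatr_eq0 -lt0n.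
Qed.

Lemma clow_Qqt_neq0 lam : clow q t lam != 0.
Proof.
apply/prodf_neq0 => i _; apply/prodf_neq0 => j _.
by rewrite subr_eq0 eq_sym qt_generic // addnS.
Qed.

Lemma cup_Qqt_neq0 lam : cup q t lam != 0.
Proof.
apply/prodf_neq0 => i _; apply/prodf_neq0 => j _.
by rewrite subr_eq0 eq_sym qt_generic.
Qed.

End GenericParameters.

Theorem proposition3p6
    (P : intpart -> symfun Qqt) (P_mac : macdonald_functions q t P)
    (a : nat -> intpart -> Qqt)
    (a_def : forall lam, ns_expansion q t lam (fun k => a k lam))
    (k : nat) (k_gt0 : (0 < k)%N)
    (Pstar : mpfam Qqt)
    (Pstar_def : shifted_macdonald q^-1 t^-1 (colpart k) Pstar)
    (F : nat -> symfun Qqt) (F_def : ns_series q t P a k F) :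
  let Pstar_at lam := shifted_eval q^-1 (colpart k) Pstar lam in
  (forall lam : intpart,
     ns_operator P a k (P lam) = a k lam *: P lam /\
     a k lam = t ^- 'C(k, 2) * Pstar_at lam) /\
  (forall n, (k <= n)%N ->
     (n`!%:R : Qqt)^-1 *: F n
     = t ^- 'C(k, 2) *:
       \sum_(lam <- partitions n) (Pstar_at lam / cup q t lam) *: P lam).
Proof.
have [P_unitri _] := P_mac => Pstar_at.
have a_Pstar lam : a k lam = t ^- 'C(k, 2) * Pstar_at lam.
  exact: (ns_expansion_shifted_macdonald q_neq0 t_neq0 qt_generic).
split=> [lam|n kn]; first by split=> //; exact: ns_operator_eigen.
rewrite (ns_series_expand P_unitri clow_Qqt_neq0 cup_Qqt_neq0 _ F_def kn).
  by rewrite scaler_sumr; apply: eq_bigr => lam _; rewrite a_Pstar scalerA mulrA.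
by rewrite natr_Qqt_neq0 // fact_gt0.
Qed.
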